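(* Let the algorithm Perishing-Guardrail be run with envy parameter $L_T$ and high-probability parameter $\delta\in(0,1)$. Suppose $L_T\gtrsim1/\sqrt T$ and $\mathcal L^{\mathrm{perish}}\lesssim1/\sqrt T$. (i) If $T\mathcal L^{\mathrm{perish}}\lesssim L_T^{-1}$, then with probability at least $1-2\delta$: $\Delta_{EF}\lesssim L_T$ and $\Delta_{\mathrm{efficiency}}\lesssim L_T^{-1}$. (ii) If $T\mathcal L^{\mathrm{perish}}\gtrsim L_T^{-1}$, then with probability at least $1-2\delta$: $\Delta_{EF}\lesssim L_T$ and $\Delta_{\mathrm{efficiency}}\lesssim T\mathcal L^{\mathrm{perish}}$.
   Context: Model. A decision-maker has a set $\mathcal B$ of $B$ divisible units of a single resource to allocate over rounds $t\in[T]=\{1,\dots,T\}$. Individuals have types in a finite set $\Theta$; type $\theta$ has utility $w_\theta x$ for an amount $x\ge0$, $w_\theta>0$. In round $t$ a random number $N_{t,\theta}$ of type-$\theta$ individuals arrives; the $N_{t,\theta}$ are independent with known distributions and $N_{t,\theta}\ge1$ a.s. $N_t=\sum_\theta N_{t,\theta}$, $N=\sum_{t\in[T]}N_t$, $\mathbb E[N]=\Theta(T)$, $\beta_{avg}=B/\mathbb E[N]=\Theta(1)$. $\sigma_{t,\theta}^2=\mathrm{Var}(N_{t,\theta})<\infty$; $\rho_{t,\theta}<\infty$ is an almost sure bound on $|N_{t,\theta}-\mathbb E[N_{t,\theta}]|$; $w_{max}=\max_\theta w_\theta$, $\mu_{\max}=\max_t\mathbb E[N_t]$, $\sigma^2_{\min}=\min\sigma^2_{t,\theta}$,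 $\sigma^2_{\max}=\max\sigma^2_{t,\theta}$, $\rho_{\max}=\max\rho_{t,\theta}$. Unit $b$ has a random perishing time $T_b\in\{1,2,\dots\}$ with known distribution, independent across units and of arrivals; any unallocated part of $b$ spoils at the end of round $T_b$, after that round's allocation. A fixed allocation schedule is a bijection $\sigma:\mathcal B\to\{1,\dots,B\}$; units are handed out in increasing order of $\sigma$ among those still (partly) unallocated and unspoiled. $X^{alg}_{t,\theta}$ is the amount given to each type-$\theta$ individual in round $t$; $B_1^{alg}=B$ and $B_{t+1}^{alg}=B_t^{alg}-\sum_\theta N_{t,\theta}X^{alg}_{t,\theta}-PUA^{alg}_t$, with $PUA_t^{alg}$ the quantity of unallocated resource perishing at the end of round $t$. For time-indexed $Y_t$: $Y_{<t}=\sum_{t'<t}Y_{t'}$, and similarly $Y_{\le t},Y_{>t},Y_{\ge t},Y_{(t,t']},Y_{[t,t']}$. Metrics. $\Delta_{EF}=\max_{t,\theta}|w_\theta(X^{alg}_{t,\theta}-B/N)|$; $\Delta_{\mathrm{efficiency}}=B-\sum_{t,\theta}N_{t,\theta}X^{alg}_{t,\theta}$. Confidence terms. For $t'>t$, $\mathrm{Conf}^N_{t,t'}=\sqrt{2(t'-t)|\Theta|\rho_{\max}^2\log(2T^2/\delta)}$ ($\mathrm{Conf}^N_{t,t}=0$), and $\mathrm{Conf}^P_t(\eta)=\frac12\big(\log(3t\log T/\delta)+\sqrt{\log^2(3t\log T/\delta)+8\eta\log(3t\log T/\delta)}\big)$. Forecasts. $\overline N=\mathbb E[N]+\mathrm{Conf}^N_{0,T}$,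 $\overline N_{>t}=\mathbb E[N_{>t}]+\mathrm{Conf}^N_{t,T}$, $\underline N_{[t,t']}=\mathbb E[N_{[t,t']}]-\mathrm{Conf}^N_{t-1,t'}$, $\underline N_{\le t}=\underline N_{[1,t]}$, $\underline N_{<t}=\underline N_{[1,t-1]}$ ($\underline N_{<1}=0$). For $X\ge0$, $$\tau_b(t\mid X,\sigma)=\inf\{t'\ge t:\underline N_{<t}X+\underline N_{[t,t']}X\ge\sigma(b)\}\ (\inf\emptyset=\infty),\ \text{and for } t=1:\ \tau_b(1\mid X,\sigma)=\inf\{t'\ge1:\underline N_{\le t'}X\ge\sigma(b)\},$$ $$\mu(X)=\sum_{b\in\mathcal B}\Pr(T_b<\min\{T,\tau_b(1\mid X,\sigma)\}),\quad \overline\Delta(X)=\min\{B,\mu(X)+\mathrm{Conf}^P_1(\mu(X))\},$$ $$\underline X=\sup\{X\mid X\le (B-\overline\Delta(X))/\overline N\}\ \text{(assumed attained)},\quad \mathcal L^{\mathrm{perish}}=B/\overline N-\underline X .$$ $\overline{\mathcal B}_t$ is the set of units of rank at least $\lceil\underline N_{<t}\underline X\rceil$ in $\sigma$, $\eta_t=\sum_{b\in\overline{\mathcal B}_t}\Pr(t\le T_b<\min\{T,\tau_b(t\mid\underline X,\sigma)\})$, $\overline P_0=B$, $\overline P_t=\min\{\overline P_{t-1},\eta_t+\mathrm{Conf}^P_t(\eta_t)\}$. Algorithm Perishing-Guardrail. Input $L_T=o(1)$. Set $\overline X=\underline X+L_T$. In each round $t=1,\dots,T$, after observing $N_t$: if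 $B_t^{alg}<N_t\underline X$, set $X^{alg}_{t,\theta}=B_t^{alg}/N_t$ for all $\theta$; else if $B_t^{alg}-N_t\overline X\ge\underline X\,\overline N_{>t}+\overline P_t$, set $X^{alg}_{t,\theta}=\overline X$ for all $\theta$; else set $X_{t,\theta}^{alg}=\underline X$ for all $\theta$. Allocate the remaining units according to $\sigma$. Notation. $\lesssim$ and $\gtrsim$ mean that the inequality holds as $T$ grows up to absolute constants and polynomial factors of $\beta_{avg},|\Theta|,w_{max},\mu_{\max},\sigma^2_{\min},\sigma^2_{\max},\rho_{\max},\log T,\log(1/\delta)$. *)

(* Defs.v *)
From HB Require Import structures.
From mathcomp Require Import all_boot all_order all_algebra all_fingroup.
From mathcomp Require Import all_classical all_reals all_analysis.
From mathcomp Require mpoly.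
(* The notations of mpoly clash with those of MathComp-Analysis. *)
Import -(notations) mpoly.

Set Implicit Arguments.
Unset Strict Implicit.
Unset Printing Implicit Defensive.
Import Order.TTheory GRing.Theory Num.Theory.

Local Open Scope classical_set_scope.
Local Open Scope ring_scope.

Definition mutually_independent (R : realType) (d : measure_display)
    (Omega : measurableType d) (P : probability Omega R) (K : finType)
    (X : K -> {RV P >-> nat}) : Prop :=
  forall (J : {set K}) (A : K -> set nat), (forall i, measurable (A i)) ->
    P (\bigcap_(i in [set i | i \in J]) (X i @^-1` A i)) =
    (\prod_(i in J) P (X i @^-1` A i))%E.

(* Rounds are numbered 1, ..., horizon; [arrival] and [rho] are only ever used
   at those rounds.  The law of the random variables is whatever [prob] makes
   it; no common probability space is imposed on different instances. *)
Record instance (R : realType) := Instance {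
  disp : measure_display;
  Omega : measurableType disp;
  prob : probability Omega R;
  Theta : finType;
  horizon : nat;
  nunits : nat;
  util : Theta -> R;
  arrival : nat -> Theta -> {RV prob >-> nat};
  perishing : 'I_nunits -> {RV prob >-> nat};
  rho : nat -> Theta -> R;
  schedule : {perm 'I_nunits};
  delta : R;
  envy : R
}.

Arguments Theta {R} i.
Arguments nunits {R} i.
Arguments util {R} i th : rename.
Arguments arrival {R} i t th : rename.
Arguments perishing {R} i b : rename.
Arguments rho {R} i t th : rename.
Arguments schedule {R} i.

Section Model.
Variables (R : realType) (I : instance R).

Local Notation T := (horizon I).
Local Notation B := ((nunits I)%:R : R).
Local Notation P := (prob I).
Local Notation unit_ := 'I_(nunits I).

(* ['I_(nunits I)] is 0-based whereas ranks run over 1, ..., B. *)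
Definition rank (b : unit_) : nat := (schedule I b).+1.

(* N_(t, t'] ; the closed range [t, t'] is (t - 1, t']. *)
Definition arrivals (t t' : nat) (w : Omega I) : nat :=
  (\sum_(t.+1 <= s < t'.+1) \sum_(th : Theta I) arrival I s th w)%N.

Definition arrivals_at (t : nat) (w : Omega I) : nat :=
  (\sum_(th : Theta I) arrival I t th w)%N.

Definition arrivals_total (w : Omega I) : nat := arrivals 0 T w.

Definition mean_arrivals (t t' : nat) : R :=
  fine 'E_P[fun w => (arrivals t t' w)%:R].

Definition mean_total : R := mean_arrivals 0 T.

Definition mean_arrival (t : nat) (th : Theta I) : R :=
  fine 'E_P[fun w => (arrival I t th w)%:R].

Definition var_arrival (t : nat) (th : Theta I) : R :=
  fine 'V_P[fun w => (arrival I t th w)%:R].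

Definition beta_avg : R := B / mean_total.

(* All the quantities maximized are nonnegative, so 0 is a neutral default. *)
Definition util_max : R := \big[Num.max/0]_(th : Theta I) util I th.

Definition mu_max : R :=
  \big[Num.max/0]_(1 <= t < T.+1) fine 'E_P[fun w => (arrivals_at t w)%:R].

Definition var_max : R :=
  \big[Num.max/0]_(1 <= t < T.+1) \big[Num.max/0]_(th : Theta I)
    var_arrival t th.

(* Taking the maximum as default value yields the genuine minimum. *)
Definition var_min : R :=
  \big[Num.min/var_max]_(1 <= t < T.+1) \big[Num.min/var_max]_(th : Theta I)
    var_arrival t th.

Definition rho_max : R :=
  \big[Num.max/0]_(1 <= t < T.+1) \big[Num.max/0]_(th : Theta I) rho I t th.

Definition params (i : 'I_9) : R :=
  tnth [tuple beta_avg; #|Theta I|%:R; util_max; mu_max; var_min; var_max;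
              rho_max; ln T%:R; ln (delta I)^-1] i.

Definition confN (t t' : nat) : R :=
  Num.sqrt (2 * (t' - t)%N%:R * #|Theta I|%:R * rho_max ^+ 2
            * ln (2 * T%:R ^+ 2 / delta I)).

Definition confP (t : nat) (eta : R) : R :=
  let l := ln (3 * t%:R * ln T%:R / delta I) in
  2^-1 * (l + Num.sqrt (l ^+ 2 + 8 * eta * l)).

(* Upper and lower forecasts of N_(t, t'].  For t' = t both are 0. *)
Definition upN (t t' : nat) : R := mean_arrivals t t' + confN t t'.

Definition lowN (t t' : nat) : R := mean_arrivals t t' - confN t t'.

(* As lowN 0 0 = 0, the case t = 1 needs no separate clause. *)
Definition tau (t : nat) (X : R) (b : unit_) : \bar R :=
  ereal_inf [set (t'%:R)%:E | t' in
    [set t' : nat | (t <= t' <= T)%N /\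
       (rank b)%:R <= lowN 0 t.-1 * X + lowN t.-1 t' * X]].

Definition mu (X : R) : R :=
  \sum_(b : unit_) fine (P [set w |
    (((perishing I b w)%:R)%:E < Order.min (T%:R)%:E (tau 1 X b))%E]).

Definition Delta_bar (X : R) : R := Num.min B (mu X + confP 1 (mu X)).

Definition feasible_rates : set R :=
  [set X | 0 <= X /\ X <= (B - Delta_bar X) / upN 0 T].

Definition X_low : R := sup feasible_rates.

Definition X_high : R := X_low + envy I.

Definition L_perish : R := B / upN 0 T - X_low.

Definition eta (t : nat) : R :=
  \sum_(b : unit_ | (Num.ceil (lowN 0 t.-1 * X_low) <= (rank b)%:Z)%R)
    fine (P [set w | (t <= perishing I b w)%N /\
      (((perishing I b w)%:R)%:E <
        Order.min (T%:R)%:E (tau t X_low b))%E]).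

Fixpoint P_bar (t : nat) : R :=
  match t with
  | 0%N => B
  | t'.+1 => Num.min (P_bar t') (eta t'.+1 + confP t'.+1 (eta t'.+1))
  end.

Record state := State {
  budget : R;
  leftover : unit_ -> R  (* part of each unit neither allocated nor spoiled *)
}.

(* The common value of X^alg_(t, theta), given the budget B_t^alg. *)
Definition guardrail (t : nat) (w : Omega I) (b_t : R) : R :=
  let n_t : R := (arrivals_at t w)%:R in
  if b_t < n_t * X_low then b_t / n_t
  else if X_low * upN t T + P_bar t <= b_t - n_t * X_high then X_high
  else X_low.

(* What unit b contributes when the amount a is handed out in schedule order. *)
Definition taken (u : unit_ -> R) (a : R) (b : unit_) : R :=
  Num.min (u b) (Num.max 0 (a - \sum_(b' : unit_ | (rank b' < rank b)%N) u b')).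

Definition round (t : nat) (w : Omega I) (s : state) : state :=
  let x := guardrail t w (budget s) in
  let a := \sum_(th : Theta I) (arrival I t th w)%:R * x in
  let u b := leftover s b - taken (leftover s) a b in
  let pua := \sum_(b : unit_ | perishing I b w == t) u b in
  State (budget s - a - pua)
        (fun b => if perishing I b w == t then 0 else u b).

(* State at the end of round t; it starts round t + 1. *)
Fixpoint run (w : Omega I) (t : nat) : state :=
  match t with
  | 0%N => State B (fun=> 1)
  | t'.+1 => round t'.+1 w (run w t')
  end.

Definition X_alg (t : nat) (th : Theta I) (w : Omega I) : R :=
  guardrail t w (budget (run w t.-1)).

Definition Delta_EF (w : Omega I) : R :=
  \big[Num.max/0]_(1 <= t < T.+1) \big[Num.max/0]_(th : Theta I)
    `| util I th * (X_alg t th w - B / (arrivals_total w)%:R) |.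

Definition Delta_efficiency (w : Omega I) : R :=
  B - \sum_(1 <= t < T.+1) \sum_(th : Theta I)
        (arrival I t th w)%:R * X_alg t th w.

Definition primitives (i : ('I_T * Theta I + unit_)%type) : {RV P >-> nat} :=
  match i with
  | inl (s, th) => arrival I s.+1 th
  | inr b => perishing I b
  end.

Record standing : Prop := Standing {
  util_gt0 : forall th : Theta I, 0 < util I th;
  primitives_indep : mutually_independent primitives;
  arrival_ge1 : forall t th, (1 <= t <= T)%N ->
    {ae P, forall w, (1 <= arrival I t th w)%N};
  arrival_var : forall t th, (1 <= t <= T)%N ->
    ('V_P[fun w => (arrival I t th w)%:R] < +oo)%E;
  arrival_bound : forall t th, (1 <= t <= T)%N ->
    {ae P, forall w, `|(arrival I t th w)%:R - mean_arrival t th| <= rho I t th};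
  perishing_ge1 : forall b w, (1 <= perishing I b w)%N;
  delta_range : 0 < delta I < 1;
  X_low_attained : feasible_rates X_low
}.

End Model.

Arguments Delta_EF {R} I w.
Arguments Delta_efficiency {R} I w.

(* Asymptotics over a family of instances as the horizon grows.  The parameters
   (and the probability space) may vary along the family; hidden constants and
   polynomials may not.  A sequence indexed by T is the case J = nat. *)
Section Asymptotics.
Variables (R : realType) (J : Type) (I : J -> instance R).

Definition for_large_horizon (Q : J -> Prop) : Prop :=
  exists T0 : nat, forall j, (T0 <= horizon (I j))%N -> Q j.

Definition same_order (f g : J -> R) : Prop :=
  exists c C : R, 0 < c /\ for_large_horizon (fun j => c * g j <= f j <= C * g j).

Definition vanishing (f : J -> R) : Prop :=
  forall e : R, 0 < e -> for_large_horizon (fun j => `|f j| < e).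

(* [hidden p j] is the factor hidden in an inequality at instance j. *)
Definition hidden (p : mpoly 9 R) (j : J) : R := meval (@params R (I j)) p.

Definition lesssim (f g : J -> R) : Prop :=
  exists p : mpoly 9 R, for_large_horizon (fun j =>
    0 <= hidden p j /\ f j <= hidden p j * g j).

Definition whp_lesssim2 (f1 : forall j, Omega (I j) -> R) (g1 : J -> R)
    (f2 : forall j, Omega (I j) -> R) (g2 : J -> R) : Prop :=
  exists p1 p2 : mpoly 9 R, for_large_horizon (fun j =>
    [/\ 0 <= hidden p1 j, 0 <= hidden p2 j &
     ((1 - 2 * delta (I j))%:E <=
       prob (I j) [set w | (f1 j w <= hidden p1 j * g1 j)%R /\
                           (f2 j w <= hidden p2 j * g2 j)%R])%E]).

End Asymptotics.

(* Main.v *)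
(* With high probability every window of arrivals is within its Hoeffding radius
   of its mean and, for every t, the number of units counted by eta_t is within
   its Chernoff radius; the union bounds over windows and over rounds (a
   harmonic sum) cost delta each.  On this event the argument is pathwise.

   Since units leave in schedule order, a unit of rank at most the cumulative
   allocation can no longer spoil; hence, as long as every rate is at least
   X_low, what spoils from round s on is at most P_bar s.  The threshold test
   then keeps X_low affordable forever, so every rate is X_low or X_high, while
   B/N exceeds X_low by at most L_perish plus an O(1/sqrt T) forecast error.
   For efficiency, look at the last round t0 at which the test failed: up to a
   bounded term, the waste is at most the forecast error a sqrt(T - t0) of the
   remaining arrivals, minus the L_T (T - t0) given in excess of X_low, a
   difference of at most a^2 / (4 L_T), plus twice the forecast spoilage, itself
   at most B - X_low upN = upN L_perish. *)
Require Import Defs.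
From mathcomp Require Import all_boot all_order all_algebra all_fingroup.
From mathcomp Require Import all_classical all_reals all_analysis.
From mathcomp Require Import measurable_realfun zify ring lra.
From mathcomp Require mpoly.
Import -(notations) mpoly.

Set Implicit Arguments.
Unset Strict Implicit.
Unset Printing Implicit Defensive.
Import Order.TTheory GRing.Theory Num.Theory.
Import numFieldNormedType.Exports.

Local Open Scope classical_set_scope.
Local Open Scope ring_scope.

(** * Elementary inequalities *)

Section RealInequalities.
Variable R : realType.
Implicit Types x l : R.

Lemma le_of_ge0_derive (f df : R -> R) x :
  (forall y : R, is_derive y 1 f (df y)) -> (forall y, 0 <= y -> 0 <= df y) ->
  0 <= x -> f 0 <= f x.
Proof.
move=> fE df0 x0.
have fc : {within `[0, x], continuous f}.
  apply: continuous_subspaceT => y; apply: differentiable_continuous.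
  by apply/derivable1_diffP; case: (fE y).
have [y + E] := MVT_segment x0 (fun y _ => fE y) fc.
rewrite in_itv /= => /andP[y0 _].
by rewrite -subr_ge0 E mulr_ge0 ?df0// subr0.
Qed.

(** The Pade bound [e^l <= (2 + l) / (2 - l)], cleared of its denominator so that no condition
    [l < 2] is required. The derivative of the difference is [1 - (1 - l) e^l], nonnegative because
    [1 - l <= e^(-l)]. It serves both the cosh bound and the Chernoff exponent. *)
Lemma expR_le_pade l : 0 <= l -> (2 - l) * expR l <= 2 + l.
Proof.
move=> l0; rewrite -subr_ge0.
pose f l : R := 2 + l - (2 - l) * expR l.
have := @le_of_ge0_derive f (fun l => 1 - (1 - l) * expR l) l _ _ l0.
have -> : f 0 = 0 by rewrite /f expR0; ring.
apply.
  move=> y; apply: is_derive_eq; rewrite /GRing.scale /=; ring.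
move=> y _; rewrite subr_ge0.
have := expR_ge1Dx (- y); rewrite expRN => h.
have e0 := expR_gt0 y.
by rewrite -ler_pdivlMr// mul1r.
Qed.

(** The function [e^(-x^2/2) (e^x + e^(-x))] decreases for [x >= 0]: the sign of its derivative
    amounts to [sinh x <= x cosh x], which is the Pade bound at [2 x]. *)
Lemma cosh_le_ge0 x : 0 <= x -> expR x + expR (- x) <= 2 * expR (x ^+ 2 / 2).
Proof.
move=> x0.
pose f (x : R) : R := - (expR (- (x ^+ 2 / 2)) * (expR x + expR (- x))).
have := @le_of_ge0_derive f
  (fun x => expR (- (x ^+ 2 / 2)) *
     (x * (expR x + expR (- x)) - (expR x - expR (- x)))) x _ _ x0.
have -> : f 0 = - 2 by rewrite /f expr0n /= mul0r oppr0 expR0; ring.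
have H : f x = - ((expR (x ^+ 2 / 2))^-1 * (expR x + expR (- x))).
  by rewrite /f expRN.
rewrite H lerN2 ler_pdivrMl ?expR_gt0// mulrC; apply.
  move=> y; apply: is_derive_eq; rewrite /GRing.scale /=.
  by field.
move=> y y0; apply: mulr_ge0; first exact: expR_ge0.
have := @expR_le_pade (2 * y) (mulr_ge0 (ler0n _ 2) y0).
have -> : 2 * y = y + y by ring.
rewrite expRD => h.
have e0 := expR_gt0 (- y).
have E := expRxMexpNx_1 y.
have := ler_wpM2r (ltW e0) h.
have -> : (2 - (y + y)) * (expR y * expR y) * expR (- y) =
  (2 - (y + y)) * expR y * (expR y * expR (- y)) by ring.
rewrite E mulr1; nra.
Qed.

Lemma cosh_le x : expR x + expR (- x) <= 2 * expR (x ^+ 2 / 2).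
Proof.
have [x0|x0] := leP 0 x; first exact: cosh_le_ge0.
have := @cosh_le_ge0 (- x); rewrite opprK sqrrN addrC; apply; lra.
Qed.

(** By induction: [ln (1 - x) <= - x] at [x = 1/(n+2)] bounds the new term by
    [ln (n+2) - ln (n+1)]. *)
Lemma harmonic_le_ln (n : nat) : (0 < n)%N ->
  \sum_(1 <= t < n.+1) (t%:R : R)^-1 <= 1 + ln n%:R.
Proof.
elim: n => // -[_ _|n IH _].
  by rewrite big_nat1 ln1 addr0 invr1.
rewrite big_nat_recr//= (le_trans (lerD (IH isT) (lexx _)))//.
rewrite -addrA lerD2l -lerBrDl.
have := @le_ln1Dx R (- (n.+2%:R)^-1).
have n2 : 0 < n.+2%:R :> R by rewrite ltr0n.
have n1 : 0 < n.+1%:R :> R by rewrite ltr0n.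
rewrite ltrN2 invf_lt1// ltr1n => /(_ isT).
have -> : 1 - n.+2%:R^-1 = n.+1%:R / n.+2%:R :> R.
  by field; rewrite ?gt_eqF.  
rewrite ln_div ?posrE// => h; by rewrite -lerN2 opprB.
Qed.
End RealInequalities.

(** * Tail bounds for independent integer-valued variables *)

Section MomentFactors.
Variables (R : realType) (F : finType) (q v : F -> R).
Hypothesis q0 : forall f, 0 <= q f.
Hypothesis q1 : \sum_f q f = 1.

(** The tangent at the convex combination [c] lies below [expR]; averaging it over the two endpoints
    cancels the linear term. *)
Lemma expR_chord (t a b : R) : 0 <= t <= 1 ->
  expR ((1 - t) * a + t * b) <= (1 - t) * expR a + t * expR b.
Proof.
move=> /andP[t0 t1]; set c := _ + t * b.
have tangent z : expR c * (1 + (z - c)) <= expR z.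
  have -> : expR z = expR c * expR (z - c) by rewrite -expRD subrKC.
  by apply: ler_wpM2l; [exact: expR_ge0|exact: expR_ge1Dx].
have t1' : 0 <= 1 - t by rewrite subr_ge0.
apply: le_trans (lerD (ler_wpM2l t1' (tangent a)) (ler_wpM2l t0 (tangent b))).
by rewrite le_eqVlt; apply/orP; left; apply/eqP; rewrite /c; ring.
Qed.

(** The interval is centred at the mean, so averaging the chord bound removes the linear part and
    leaves [cosh (l r)]. The range condition concerns only values of nonzero mass, which lets it be
    checked almost surely. *)
Lemma hoeffding_lemma (m r l : R) :
  \sum_f q f * v f = m -> (forall f, q f != 0 -> `|v f - m| <= r) ->
  \sum_f q f * expR (l * (v f - m)) <= expR (l ^+ 2 * r ^+ 2 / 2).
Proof.
(* For [r <= 0] all the mass sits at [m]; treating this case first makes the chord's denominator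
   [2 r] positive. *)
move=> qm qr; have [r0|r0] := leP r 0.
  rewrite (eq_bigr q) ?q1 -?expR0 ?ler_expR.
    by rewrite mulr_ge0// mulr_ge0// sqr_ge0.
  move=> f _; have [->|/qr] := eqVneq (q f) 0; first by rewrite mul0r.
  move=> /le_trans/(_ r0); rewrite normr_le0 => /eqP ->.
  by rewrite mulr0 expR0 mulr1.
pose A := expR (l * r); pose A' := expR (- (l * r)).
(* On [-r, r] the convex function y |-> expR (l * y) lies below its chord. *)
apply: (@le_trans _ _ (\sum_f (q f * ((A + A') / 2) +
    (q f * v f - q f * m) * ((A - A') / (2 * r))))).
  apply: ler_sum => f _; have [->|qf] := eqVneq (q f) 0.
    by rewrite !mul0r subrr mul0r addr0.
  have := qr _ qf; rewrite ler_norml => /andP[h1 h2].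
  pose t := (r + (v f - m)) / (2 * r).
  have r2 : 0 < 2 * r by lra.
  have tE : t * (2 * r) = r + (v f - m) by rewrite /t divfK// gt_eqF.
  have t01 : 0 <= t <= 1.
    by rewrite /t divr_ge0 ?ler_pdivrMr//=; lra.
  have := @expR_chord t (- (l * r)) (l * r) t01.
  have -> : (1 - t) * - (l * r) + t * (l * r) = l * (v f - m).
    have -> : v f - m = t * (2 * r) - r by rewrite tE; ring.
    by ring.
  rewrite -/A -/A' => h.
  apply: (le_trans (ler_wpM2l (q0 f) h)).
  rewrite le_eqVlt; apply/orP; left; apply/eqP.
  rewrite -mulrBr.
  have -> : v f - m = t * (2 * r) - r by rewrite tE; ring.
  by field; rewrite gt_eqF.
rewrite big_split/= -mulr_suml q1 mul1r -mulr_suml sumrB qm -mulr_suml q1.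
rewrite mul1r subrr mul0r addr0.
rewrite ler_pdivrMr// mulrC [leRHS]mulrC; have := cosh_le (l * r).
by rewrite exprMn mulrC.
Qed.

End MomentFactors.

(** * Independent variables seen through a finite-valued map *)

Section FiniteLaw.
Variables (R : realType) (d : measure_display) (Om : measurableType d).
Variables (P : probability Om R) (K F : finType).
Variables (X : K -> {RV P >-> nat}) (h : K -> nat -> F).
Hypothesis indep : mutually_independent X.

Lemma measurable_preimage_nat (Y : {RV P >-> nat}) (A : set nat) :
  measurable (Y @^-1` A).
Proof. exact: measurable_funPTI. Qed.

(** Finitely many integer-valued variables cut the space into countably many measurable cells, and a
    set that depends on them alone is a union of cells. This gives the measurability of every event
    below without inspecting its formula. *)
Lemma measurable_determined (S : set Om) :
  (forall w w', (forall i, X i w = X i w') -> S w -> S w') -> measurable S.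
Proof.
move=> SX.
pose cell (k : {ffun K -> nat}) := \bigcap_(i in [set: K]) X i @^-1` [set k i].
have -> : S = \bigcup_(k : {ffun K -> nat}) (cell k `&`
    [set w | exists2 w', cell k w' & S w']).
  apply/seteqP; split => [w Sw|w [k _ [kw [w' kw' Sw']]]].
    have cw : cell [ffun i => X i w] w by move=> i _ /=; rewrite ffunE.
    by exists [ffun i => X i w] => //; split => //; exists w.
  apply: SX Sw' => i.
  by have := kw i I; have := kw' i I => /= -> ->.
apply: countable_bigcupT_measurable; first exact: countableP.
move=> k.
have mc : measurable (cell k).
  apply: fin_bigcap_measurable => [|i _]; first exact: finite_finset.
  exact: measurable_preimage_nat.
have [e|ne] := pselect (exists2 w', cell k w' & S w').
  by rewrite (_ : [set _ | _] = setT) ?setIT//; apply/seteqP; split.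
by rewrite (_ : [set _ | _] = set0) ?setI0//; apply/seteqP; split.
Qed.

Lemma probability_bigsetU_le (T : Type) (s : seq T) (Q : pred T)
    (A : T -> set Om) :
  (forall i, Q i -> measurable (A i)) ->
  (P (\big[setU/set0]_(i <- s | Q i) A i) <= \sum_(i <- s | Q i) P (A i))%E.
Proof.
move=> mA; elim: s => [|x s IH]; first by rewrite !big_nil measure0.
rewrite !big_cons; case: ifP => // Qx.
apply: le_trans (leeD2l _ IH); apply: measureU2; first exact: mA.
exact: bigsetU_measurable.
Qed.

Definition law i f : R := fine (P (X i @^-1` [set n | h i n = f])).

Lemma law_ge0 i f : 0 <= law i f.
Proof. exact: fine_ge0. Qed.

Lemma EFin_law i f : (law i f)%:E = P (X i @^-1` [set n | h i n = f]).
Proof.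
by rewrite /law fineK// fin_num_measure//; exact: measurable_preimage_nat.
Qed.

Lemma expectation_law i (phi : F -> R) :
  ('E_P[fun w => phi (h i (X i w))] = (\sum_f law i f * phi f)%:E)%E.
Proof.
pose A f := X i @^-1` [set n | h i n = f].
have mA f : measurable (A f) by exact: measurable_preimage_nat.
rewrite unlock.
transitivity (\int[P]_w (\sum_f (phi f)%:E * (\1_(A f) w)%:E))%E.
  apply: eq_integral => w _.
  rewrite (bigD1 (h i (X i w)))//= big1 => [|f /eqP nf].
    by rewrite indicE mem_set// mule1 adde0.
  by rewrite indicE memNset ?mule0//= => e; apply: nf.
rewrite integral_sum//= => [|f]; last first.
  by apply: integrableZl => //; exact: integrable_indic.
rewrite -sumEFin; apply: eq_bigr => f _.
rewrite integralZl//; last exact: integrable_indic.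
by rewrite integral_indic// setIT EFinM EFin_law muleC.
Qed.

Lemma law_sum1 i : \sum_f law i f = 1.
Proof.
apply: EFin_inj; have := expectation_law i (fun=> 1).
rewrite expectation_cst => ->.
by congr EFin; apply: eq_bigr => f _; rewrite mulr1.
Qed.

(** The event is covered by the cells of the value vectors satisfying [Q]; independence makes the
    probability of each cell a product. *)
Lemma probability_le_law (Q : pred {ffun K -> F}) :
  (P [set w | Q [ffun i => h i (X i w)]] <=
   (\sum_(k | Q k) \prod_i law i (k i))%:E)%E.
Proof.
pose A i f := X i @^-1` [set n | h i n = f].
pose cell (k : {ffun K -> F}) :=
  \bigcap_(i in [set i | i \in [set: K]%SET]) A i (k i).
have mc k : measurable (cell k).
  apply: fin_bigcap_measurable => [|i _]; first exact: finite_finset.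
  exact: measurable_preimage_nat.
have cellE k : P (cell k) = (\prod_i law i (k i))%:E.
  rewrite /cell (indep _ (A := fun i => [set n | h i n = k i]))//.
  rewrite -prodEFin big_mkcond/=; apply: eq_bigr => i _.
  by rewrite inE EFin_law.
apply: (@le_trans _ _ (P (\big[setU/set0]_(k | Q k) cell k))).
  apply: le_measure; rewrite ?inE.
  - apply: measurable_determined => w w' e /=; congr (is_true (Q _)).
    by apply/ffunP => i; rewrite !ffunE e.
  - by apply: bigsetU_measurable => k _.
  move=> w Qw; rewrite (bigD1 [ffun i => h i (X i w)])//=; left => i _.
  by rewrite /A /= ffunE.
apply: le_trans; first by apply: probability_bigsetU_le.
by rewrite -sumEFin; apply: lee_sum => k _; rewrite cellE.
Qed.

(** Exponential Markov inequality in finite form: on the event the weight [expR (sum - e)] is at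
    least 1, and distributivity turns the sum over value vectors into a product of moment generating
    functions. *)
Lemma chernoff (g : K -> F -> R) (e : R) :
  (P [set w | (e <= \sum_i g i (h i (X i w)))%R] <=
   (expR (- e) * \prod_i \sum_f law i f * expR (g i f))%:E)%E.
Proof.
have -> : [set w | e <= \sum_i g i (h i (X i w))] =
  [set w | (fun k : {ffun K -> F} => e <= \sum_i g i (k i))
     [ffun i => h i (X i w)]].
  apply/seteqP; split => w /=.
    by under [X in _ -> _ <= X]eq_bigr do rewrite ffunE.
  by under eq_bigr do rewrite ffunE.
apply: (le_trans (probability_le_law (fun k => e <= \sum_i g i (k i)))).
rewrite lee_fin.
rewrite bigA_distr_bigA mulr_sumr big_mkcond/=. apply: ler_sum => k _.
rewrite big_split/= mulrCA.
have l0 : 0 <= \prod_i law i (k i) by apply: prodr_ge0 => i _; exact: law_ge0.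
case: ifPn => [ek|_]; last first.
  by rewrite !mulr_ge0 ?expR_ge0// prodr_ge0// => i _; exact: expR_ge0.
by rewrite -expR_sum -expRD ler_peMr// -expR0 ler_expR addrC subr_ge0.
Qed.

End FiniteLaw.

(** * Truncation of almost surely bounded variables *)

Section AlmostSurelyBounded.
Variables (R : realType) (d : measure_display) (Om : measurableType d).
Variables (P : probability Om R).

Lemma le_probability_ae (A B : set Om) : measurable A -> measurable B ->
  {ae P, forall w, A w -> B w} -> (P A <= P B)%E.
Proof.
move=> mA mB [N [mN N0 sub]].
apply: (@le_trans _ _ (P (B `|` N))).
  apply: le_measure; rewrite ?inE//; first exact: measurableU.
  move=> w Aw; have [Bw|nB] := pselect (B w); first by left.
  by right; apply: sub => /= /(_ Aw).
by apply: (le_trans (measureU2 _ _ _)) => //; rewrite -[leRHS]adde0 -N0.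
Qed.

Variables (Y : {RV P >-> nat}) (M : nat).
Hypothesis YM : {ae P, forall w, (Y w <= M)%N}.

(** Capping at [M] changes [Y] only on a null set and makes it finite-valued, so that its
    expectation becomes a finite sum. *)
Let cap (n : nat) : 'I_M.+1 := inord (minn n M).

Let capE : {ae P, forall w, (cap (Y w) : nat) = Y w}.
Proof.
apply: filterS YM => w Yw.
by rewrite /cap inordK ?ltnS ?geq_minr//; apply/minn_idPl.
Qed.

Lemma measurable_comp_nat (phi : nat -> R) :
  measurable_fun setT (fun w => (phi (Y w))%:E).
Proof.
apply/measurable_EFinP => _ A mA; rewrite setTI.
exact: (measurable_preimage_nat Y [set n | A (phi n)]).
Qed.

Lemma expectation_capped :
  ('E_P[fun w => (Y w)%:R] = 'E_P[fun w => (cap (Y w))%:R])%E.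
Proof.
rewrite unlock; apply: ae_eq_integral => //.
- exact: measurable_comp_nat.
- exact: (measurable_comp_nat (fun n => (cap n)%:R)).
by apply: filterS capE => w -> _.
Qed.

Lemma integrable_bounded_nat : P.-integrable setT (fun w => ((Y w)%:R)%:E).
Proof.
apply/integrableP; split; first exact: measurable_comp_nat.
under eq_integral do rewrite gee0_abs ?lee_fin//.
have := expectation_capped; rewrite unlock => ->.
have := expectation_law (K := unit) (fun=> Y) (fun=> cap) tt
  (fun f : 'I_M.+1 => f%:R).
by rewrite unlock => ->; rewrite ltry.
Qed.

End AlmostSurelyBounded.

(** * Hoeffding and Chernoff tails *)

Section Tails.
Variables (R : realType) (d : measure_display) (Om : measurableType d).
Variables (P : probability Om R) (K : finType).
Variables (X : K -> {RV P >-> nat}).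
Hypothesis indep : mutually_independent X.

(** The variables in [J] are capped at a common [M], and indices outside [J] receive the weight 0,
    hence the factor 1. The coefficient [l] is left free, in size and in sign, so that one statement
    gives both tails after optimization. *)
Lemma hoeffding_tail (J : pred K) (r l e : R) :
  let m i := fine ('E_P[fun w => (X i w)%:R])%E in
  (forall i, J i -> {ae P, forall w, `|(X i w)%:R - m i| <= r}) ->
  (P [set w | (e <= \sum_(i | J i) l * ((X i w)%:R - m i))%R] <=
   (expR (- e + l ^+ 2 * r ^+ 2 / 2 *+ #|J|))%:E)%E.
Proof.
move=> m Xr.
pose M := \max_(i | J i) Num.truncn (m i + r).
have XM i : J i -> {ae P, forall w, (X i w <= M)%N}.
  move=> Ji; apply: filterS (Xr _ Ji) => w.
  rewrite ler_norml => /andP[_]; rewrite lerBlDl => h.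
  apply: leq_trans (leq_bigmax_cond _ Ji).
  by rewrite truncn_ge_nat// (le_trans _ h).
pose cap (i : K) (n : nat) : 'I_M.+1 := inord (minn n M).
have capE i : J i -> {ae P, forall w, (cap i (X i w) : nat) = X i w}.
  move=> Ji; apply: filterS (XM _ Ji) => w Yw.
  by rewrite /cap inordK ?ltnS ?geq_minr//; apply/minn_idPl.
pose g i (f : 'I_M.+1) : R := if J i then l * (f%:R - m i) else 0.
apply: (@le_trans _ _ (P [set w | (e <= \sum_i g i (cap i (X i w)))%R])).
  apply: le_probability_ae.
  - apply: (measurable_determined (X := X)) => w w' h /=.
    by under eq_bigr do rewrite h.
  - apply: (measurable_determined (X := X)) => w w' h /=.
    by under eq_bigr do rewrite h.
  have : {ae P, forall w i, J i -> (cap i (X i w) : nat) = X i w}.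
    apply: filter_forall => i.
    have [Ji|nJi] := boolP (J i); first by apply: filterS (capE i Ji) => w.
    by apply: aeW.
  apply: filterS => w h /=; rewrite big_mkcond/=.
  congr (is_true (e <= _)); apply: eq_bigr => i _; rewrite /g.
  by case: ifP => // Ji; rewrite h.
apply: le_trans (chernoff cap indep _ _) _; rewrite lee_fin expRD.
apply: ler_wpM2l; first exact: expR_ge0.
rewrite -sumr_const expR_sum [leRHS]big_mkcond/=.
apply: ler_prod => i _; apply/andP; split.
  by apply: sumr_ge0 => f _; rewrite mulr_ge0 ?expR_ge0 ?law_ge0.
rewrite /g unfold_in; case: ifPn => [Ji|_]; last first.
  by under eq_bigr do rewrite expR0 mulr1; rewrite law_sum1.
apply: hoeffding_lemma.
- by move=> f; exact: law_ge0.
- exact: law_sum1.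
- apply: EFin_inj; rewrite -(expectation_law X cap i (fun f : 'I_M.+1 => f%:R)).
  rewrite -(expectation_capped (XM _ Ji)) fineK//.
  have := integrable_fin_num measurableT (integrable_bounded_nat (XM _ Ji)).
  by rewrite unlock.
(* A capped value farther than [r] from the mean is reached only on a null set, so its mass is
   zero. *)
move=> f; apply: contra_neqT; rewrite -ltNge => fr.
apply: EFin_inj; rewrite EFin_law; apply/negligibleP.
  exact: measurable_preimage_nat.
have [N [mN N0 sub]] := filterI (capE _ Ji) (Xr _ Ji).
exists N; split => // w /= fE; apply: sub => /= -[capX].
by rewrite -capX fE leNgt fr.
Qed.

(** An indicator of mean [q] has moment generating function [1 + q (e^l - 1) <= exp (q (e^l - 1))],
    so only the sum of the means enters the bound. *)
Lemma bernoulli_tail (S : K -> set nat) (l e : R) : 0 < l ->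
  (P [set w | (e <= \sum_i (`[< S i (X i w) >])%:R)%R] <=
   (expR (- (l * e) + (expR l - 1) * \sum_i fine (P (X i @^-1` S i))))%:E)%E.
Proof.
move=> l0.
have -> : [set w | (e <= \sum_i (`[< S i (X i w) >])%:R)%R] =
    [set w | (l * e <= \sum_i l * (`[< S i (X i w) >])%:R)%R].
  by apply/seteqP; split => w /=; rewrite -mulr_sumr ler_pM2l.
apply: le_trans (chernoff (fun i n => `[< S i n >]) indep
  (fun _ (f : bool) => l * f%:R) _) _.
rewrite lee_fin expRD; apply: ler_wpM2l; first exact: expR_ge0.
rewrite mulr_sumr expR_sum; apply: ler_prod => i _; apply/andP; split.
  by apply: sumr_ge0 => f _; rewrite mulr_ge0 ?expR_ge0 ?law_ge0.
have := law_sum1 X (fun i n => `[< S i n >]) i.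
rewrite !big_bool /= mulr0 expR0 mulr1 mulr1.
have -> : law X (fun i n => `[< S i n >]) i true = fine (P (X i @^-1` S i)).
  rewrite /law; congr (fine (P _)); apply/seteqP; split => w /=.
    by move/asboolP.
  by move=> ?; apply/asboolP.
move=> q1; apply: le_trans (expR_ge1Dx _).
rewrite le_eqVlt; apply/orP; left; apply/eqP.
have -> : law X (fun i n => `[< S i n >]) i false =
    1 - fine (P (X i @^-1` S i)) by rewrite -q1; ring.
by ring.
Qed.
End Tails.

(** * The good event *)

Section GoodEvent.
Variables (R : realType) (I : instance R).
Hypothesis hI : standing I.
Local Notation T := (horizon I).
Local Notation P := (prob I).
Local Notation unit_ := 'I_(nunits I).
Local Notation index := ('I_T * Theta I + unit_)%type.
Local Notation d := (delta I).
Local Notation mean i := (fine ('E_P[fun w => (primitives (I := I) i w)%:R])%E).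
Hypothesis lnT1 : 1 <= ln (T%:R : R).

Lemma horizon_gt0 : (0 < T)%N.
Proof. by move: lnT1; case: T => //; rewrite ln0// ler10. Qed.

(** The index [s : 'I_T] stands for round [s + 1], so [t <= s < t'] selects the rounds in
    [(t, t']]. *)
Definition window (t t' : nat) (i : index) : bool :=
  if i is inl (s, _) then (t <= s < t')%N else false.

Lemma sum_window (V : nmodType) (f : nat -> Theta I -> V) (g : index -> V)
    t t' :
  (t' <= T)%N -> (forall s th, g (inl (s, th)) = f s.+1 th) ->
  \sum_(i | window t t' i) g i = \sum_(t.+1 <= s < t'.+1) \sum_th f s th.
Proof.
move=> t'T gf; rewrite big_sumType/= [X in _ + X]big_pred0// addr0.
rewrite big_add1/= (big_nat_widen _ _ T)//.
rewrite (big_nat_widenl _ 0)// big_mkord.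
rewrite (eq_bigl (fun p : 'I_T * Theta I => (t <= p.1 < t')%N && true));
  last by case=> s th; rewrite andbT.
rewrite (eq_bigr (fun p : 'I_T * Theta I => f p.1.+1 p.2));
  last by case=> s th _; rewrite gf.
rewrite -(pair_big (fun s : 'I_T => (t <= s < t')%N) xpredT
  (fun s th => f s.+1 th))/=.
by apply: eq_bigl => s; rewrite andbC.
Qed.

Lemma card_window t t' : (t <= t' <= T)%N ->
  #|window t t'| = ((t' - t) * #|Theta I|)%N.
Proof.
case/andP=> tt' t'T; rewrite -sum1_card.
rewrite (sum_window (V := nat) (f := fun _ _ => 1%N))//.
by rewrite sum_nat_const_nat subSS sum1_card.
Qed.

Lemma arrivalsE t t' w : (t' <= T)%N ->
  (arrivals t t' w)%:R = \sum_(i | window t t' i) (primitives i w)%:R :> R.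
Proof.
move=> t'T; rewrite (sum_window (f := fun s th => (arrival I s th w)%:R))//.
rewrite /arrivals natr_sum; apply: eq_bigr => s _.
by rewrite natr_sum.
Qed.

Lemma rho_le t th : (1 <= t <= T)%N -> rho I t th <= rho_max I.
Proof.
move=> tT; apply: (@le_trans _ _ (\big[Num.max/0]_th rho I t th)).
  by apply: le_bigmax.
apply: (@le_bigmax_seq _ _ _ _ _ _ _
  (fun t => \big[Num.max/0]_th rho I t th)) => //.
by rewrite mem_index_iota ltnS.
Qed.

Lemma window_dev t t' i : window t t' i ->
  {ae P, forall w, `|(primitives i w)%:R - mean i| <= rho_max I}.
Proof.
case: i => [[s th] _|//].
apply: filterS (arrival_bound hI (t := s.+1) th _) => [w h|].
  by apply: le_trans h _; apply: rho_le; rewrite /= ltn_ord.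
by rewrite /= ltn_ord.
Qed.

Lemma arrival_integrable s th : (1 <= s <= T)%N ->
  P.-integrable setT (fun w => ((arrival I s th w)%:R : R)%:E).
Proof.
move=> sT.
apply: (@integrable_bounded_nat _ _ _ P (arrival I s th)
  (Num.truncn (mean_arrival s th + rho I s th))).
apply: filterS (arrival_bound hI th sT) => w.
rewrite ler_norml => /andP[_]; rewrite lerBlDl => h.
by rewrite truncn_ge_nat// (le_trans _ h).
Qed.

Lemma mean_arrivalsE t t' : (t' <= T)%N ->
  mean_arrivals I t t' =
  \sum_(t.+1 <= s < t'.+1) \sum_(th : Theta I) mean_arrival s th.
Proof.
move=> t'T; rewrite /mean_arrivals unlock.
have -> : (\int[P]_w ((arrivals t t' w)%:R : R)%:E)%E =
   (\int[P]_w \sum_(i | window t t' i) ((primitives i w)%:R : R)%:E)%E.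
  by apply: eq_integral => w _; rewrite arrivalsE// sumEFin.
pose f (i : index) w : \bar R :=
  if window t t' i then ((primitives i w)%:R)%:E else 0%E.
have intf i : P.-integrable setT (f i).
  rewrite /f; case Ei : (window t t' i); last exact: integrable0.
  by case: i Ei => [[s th] _|//]; apply: arrival_integrable; rewrite /= ltn_ord.
have -> : (\int[P]_w \sum_(i | window t t' i) ((primitives i w)%:R : R)%:E)%E =
   (\int[P]_w \sum_i f i w)%E.
  by apply: eq_integral => w _; rewrite big_mkcond.
rewrite integral_sum//.
rewrite -(sum_window (g := fun i => mean i))//.
rewrite [RHS]big_mkcond/= (_ : \sum_i _ = (\sum_i fine (\int[P]_w f i w))%:E)//.
  apply: eq_bigr => i _.
  rewrite /f; case: (window t t' i); first by rewrite unlock.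
  by rewrite integral0.
rewrite -sumEFin; apply: eq_bigr => i _; rewrite fineK//.
exact: integrable_fin_num.
Qed.

Lemma arrivals_devE t t' w : (t' <= T)%N ->
  (arrivals t t' w)%:R - mean_arrivals I t t' =
  \sum_(i | window t t' i)
    ((primitives i w)%:R - mean i).
Proof.
move=> t'T; rewrite arrivalsE// mean_arrivalsE// sumrB; congr (_ - _).
by rewrite -(sum_window (g := fun i => mean i)).
Qed.

Let L : R := ln (2 * T%:R ^+ 2 / d).

Let T0 : 0 < T%:R :> R. Proof. by rewrite ltr0n horizon_gt0. Qed.

Let d0 : 0 < d. Proof. by case/andP: (delta_range hI). Qed.

Let expL : expR (- L) = d / (2 * T%:R ^+ 2).
Proof.
by rewrite expRN lnK ?invf_div// posrE divr_gt0// mulr_gt0// exprn_gt0.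
Qed.

Definition bad_arrivals t t' : set (Omega I) :=
  [set w | confN I t t' < `|(arrivals t t' w)%:R - mean_arrivals I t t'|].

(** With [v] the window size times [rho_max ^+ 2] and [e] the confidence radius, the optimal
    [l = e / v] makes the exponent [- e^2 / (2 v) = - L]; each of the two tails then costs
    [d / (2 T^2)]. *)
Lemma bad_arrivals_le t t' : (t <= t' <= T)%N ->
  (P (bad_arrivals t t') <= (d / T%:R ^+ 2)%:E)%E.
Proof.
move=> tt'.
have t'T : (t' <= T)%N by case/andP: tt'.
set n := #|window t t'|.
have nE : n%:R = (t' - t)%N%:R * #|Theta I|%:R :> R.
  by rewrite /n card_window// natrM.
have confE : confN I t t' = Num.sqrt (2 * (n%:R * rho_max I ^+ 2) * L).
  by rewrite /confN nE -/L; congr Num.sqrt; ring.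
have mbad : measurable (bad_arrivals t t').
  apply: (measurable_determined (X := @primitives R I)) => w w' h.
  by rewrite /bad_arrivals/= !arrivals_devE//; under eq_bigr do rewrite h.
pose dev w := \sum_(i | window t t' i) ((primitives i w)%:R - mean i).
have mdev (l e : R) : measurable [set w | e <= l * dev w].
  apply: (measurable_determined (X := @primitives R I)) => w w' h.
  by rewrite /=/dev; under eq_bigr do rewrite h.
(* In the degenerate case the window is empty or [rho_max] is 0: the radius vanishes, and almost
   surely so does the deviation. *)
have [v0|v0] := ltP 0 (n%:R * rho_max I ^+ 2); last first.
  have conf0 : confN I t t' = 0.
    rewrite confE (_ : n%:R * _ = 0) ?mulr0 ?mul0r ?sqrtr0//.
    by apply: le_anti; rewrite v0 mulr_ge0// sqr_ge0.
  apply: (@le_trans _ _ (P set0)); last first.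
    by rewrite measure0 lee_fin divr_ge0 ?exprn_ge0 ?ltW.
  apply: le_probability_ae => //.
  have : {ae P, forall w i,
      window t t' i -> `|(primitives i w)%:R - mean i| <= rho_max I}.
    apply: filter_forall => i.
    have [Ji|nJi] := boolP (window t t' i); last by apply: aeW.
    by apply: filterS (window_dev Ji) => w.
  apply: filterS => w h; rewrite /bad_arrivals/= conf0 arrivals_devE//.
  rewrite normr_gt0 => /eqP; apply.
  apply: big1 => i Ji; apply/eqP; rewrite -normr_le0 (le_trans (h i Ji))//.
  have n0 : 0 < n%:R :> R by rewrite ltr0n; apply/card_gt0P; exists i.
  have h2 : rho_max I ^+ 2 <= 0 by rewrite -(pmulr_rle0 _ n0).
  have : rho_max I ^+ 2 == 0 by rewrite eq_le h2 sqr_ge0.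
  by rewrite sqrf_eq0 => /eqP ->.
set v := n%:R * rho_max I ^+ 2 in v0 confE.
have L0 : 0 <= L.
  apply: ln_ge0; rewrite ler_pdivlMr// mul1r.
  have /andP[_ /ltW d1] := delta_range hI; apply: (le_trans d1).
  have : 1 <= T%:R :> R by rewrite ler1n horizon_gt0.
  nra.
pose e := confN I t t'; pose l := e / v.
have e2 : e ^+ 2 = 2 * v * L.
  by rewrite /e confE sqr_sqrtr// mulr_ge0// mulr_ge0// ltW.
have tail s : `|s| = 1 ->
    (P [set w | (l * e <= s * l * dev w)%R] <= (d / (2 * T%:R ^+ 2))%:E)%E.
  move=> s1.
  have := hoeffding_tail (primitives_indep hI) (s * l) (l * e)
    (fun i => @window_dev t t' i).
  have -> : [set w | l * e <= s * l * dev w] = [set w | l * e <=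
      \sum_(i | window t t' i) (s * l) * ((primitives i w)%:R - mean i)].
    by apply/seteqP; split => w /=; rewrite mulr_sumr.
  move=> /le_trans; apply; rewrite lee_fin -expL ler_expR exprMn.
  rewrite -real_normK ?num_real// s1 expr1n mul1r.
  rewrite -[_ *+ #|_|]mulr_natr -/n.
  have -> : l ^+ 2 * rho_max I ^+ 2 / 2 * n%:R = l ^+ 2 * v / 2.
    by rewrite /v; ring.
  have -> : - (l * e) + l ^+ 2 * v / 2 = - (e ^+ 2 / (2 * v)).
    by rewrite /l; field; rewrite gt_eqF.
  rewrite e2 le_eqVlt; apply/orP; left; apply/eqP.
  by field; rewrite gt_eqF.
apply: (@le_trans _ _ (P ([set w | (l * e <= 1 * l * dev w)%R] `|`
    [set w | (l * e <= -1 * l * dev w)%R]))).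
  apply: le_measure; rewrite ?inE//; first exact: measurableU.
  move=> w; rewrite /bad_arrivals/= arrivals_devE// -/(dev w) -/e.
  rewrite ltr_normr => h.
  have l0 : 0 <= l by rewrite divr_ge0 ?sqrtr_ge0// ltW.
  case/orP: h => /ltW h; [left|right];
    rewrite /= ?mul1r ?mulN1r ?mulNr -?mulrN; exact: ler_wpM2l.
apply: (le_trans (measureU2 _ _ _)) => //.
have -> : (d / T%:R ^+ 2)%:E =
    ((d / (2 * T%:R ^+ 2))%:E + (d / (2 * T%:R ^+ 2))%:E)%E.
  by rewrite -EFinD; congr EFin; field; rewrite gt_eqF.
by apply: leeD; apply: tail; rewrite ?normrN normr1.
Qed.
End GoodEvent.

(** * Perishing counts and the probability of the good event *)

Section GoodPerishing.
Variables (R : realType) (I : instance R).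
Local Notation T := (horizon I).
Local Notation P := (prob I).
Local Notation unit_ := 'I_(nunits I).
Local Notation d := (delta I).

Definition perish_event (t : nat) (b : unit_) (n : nat) : Prop :=
  (t <= n)%N /\ ((n%:R)%:E < Order.min (T%:R)%:E (tau t (X_low I) b))%E.

Definition relevant (t : nat) (b : unit_) : bool :=
  Num.ceil (lowN I 0 t.-1 * X_low I) <= (rank b)%:Z.

Definition perish_count (t : nat) (w : Omega I) : R :=
  \sum_(b | relevant t b) (`[< perish_event t b (perishing I b w) >])%:R.

Definition bad_perishing (t : nat) : set (Omega I) :=
  [set w | eta I t + confP I t (eta I t) < perish_count t w].

(** The almost sure bound on arrivals is made part of the event, so that everything derived from it
    is purely pathwise. *)
Definition good (w : Omega I) : Prop :=
  [/\ forall t th, (1 <= t <= T)%N -> (1 <= arrival I t th w)%N,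
      forall t t', (t <= t' <= T)%N ->
        `|(arrivals t t' w)%:R - mean_arrivals I t t'| <= confN I t t' &
      forall t, (1 <= t <= T)%N ->
        perish_count t w <= eta I t + confP I t (eta I t)].

Hypothesis hI : standing I.
Hypothesis lnT1 : 1 <= ln (T%:R : R).

Let d0 : 0 < d. Proof. by case/andP: (delta_range hI). Qed.

Definition logP (t : nat) : R := ln (3 * t%:R * ln T%:R / d).

Lemma expR_logP t : (0 < t)%N -> expR (- logP t) = d / (3 * t%:R * ln T%:R).
Proof.
move=> t0; rewrite expRN lnK ?invf_div// posrE divr_gt0//.
by rewrite !mulr_gt0 ?ltr0n// (lt_le_trans _ lnT1).
Qed.

Lemma logP_gt0 t : (0 < t)%N -> 0 < logP t.
Proof.
move=> t0; apply: ln_gt0; rewrite ltr_pdivlMr// mul1r.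
have /andP[_ d1] := delta_range hI; apply: (lt_trans d1).
have : 1 <= t%:R :> R by rewrite ler1n.
move: lnT1; nra.
Qed.

Lemma eta_ge0 t : 0 <= eta I t.
Proof. by apply: sumr_ge0 => b _; exact: fine_ge0. Qed.

Lemma confP_gt0 t e : (0 < t)%N -> 0 <= e -> 0 < confP I t e.
Proof.
move=> t0 e0; rewrite /confP -/(logP t).
by rewrite mulr_gt0// ltr_pwDl ?logP_gt0 ?sqrtr_ge0.
Qed.

(** [confP] is the positive root [x] of [x^2 = logP t * (2 e + x)], the equation under which the
    Chernoff exponent [x^2 / (2 e + x)] equals [logP t]. *)
Lemma confP_sqr t e : (0 < t)%N -> 0 <= e ->
  confP I t e ^+ 2 = logP t * (2 * e + confP I t e).
Proof.
move=> t0 e0; have l0 := logP_gt0 t0.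
have h : 0 <= logP t ^+ 2 + 8 * e * logP t.
  by rewrite addr_ge0 ?sqr_ge0// !mulr_ge0// ltW.
have := sqr_sqrtr h; rewrite /confP -/(logP t).
set s := Num.sqrt _ => sE.
have -> : (2^-1 * (logP t + s)) ^+ 2 =
  2^-1 ^+ 2 * (logP t ^+ 2 + 2 * logP t * s + s ^+ 2) by ring.
by rewrite sE; field.
Qed.

(** The count is spread over all primitive variables, with the empty event at arrivals and at
    irrelevant units, to match the form of [bernoulli_tail]. *)
Lemma perish_countE t w : perish_count t w =
  \sum_i `[< (fun i : 'I_T * Theta I + unit_ => if i is inr b then
     [set n | relevant t b /\ perish_event t b n] else set0) i (primitives i w) >]%:R.
Proof.
rewrite big_sumType/= [X in _ = X + _]big1 ?add0r.
  rewrite /perish_count big_mkcond/=; apply: eq_bigr => b _.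
  case: ifPn => hb.
    congr (GRing.natmul _ (nat_of_bool _)).
    by apply/asbool_equiv_eq; split => [|[]].
  by rewrite (_ : `[< _ >] = false)//; apply/asboolPn => -[].
by case=> s th _; rewrite (_ : `[< _ >] = false)//; apply/asboolPn.
Qed.

(** The choice [l = 2 e / (2 eta + e)] bounds the exponent by [e - l (eta + e) = - e^2 / (2 eta + e)
    = - logP t]. *)
Lemma bad_perishing_le t : (0 < t)%N ->
  (P (bad_perishing t) <= (d / (3 * t%:R * ln T%:R))%:E)%E.
Proof.
move=> t0; pose e := confP I t (eta I t).
have n0 := eta_ge0 t; have e0 : 0 < e := confP_gt0 t0 n0.
have eE : e ^+ 2 = _ := confP_sqr t0 n0.
pose S (i : 'I_T * Theta I + unit_) : set nat := if i is inr b then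
  [set n | relevant t b /\ perish_event t b n] else set0.
pose l := 2 * e / (2 * eta I t + e).
have D0 : 0 < 2 * eta I t + e by rewrite ltr_wpDl// mulr_ge0.
have l0 : 0 < l by rewrite divr_gt0// mulr_gt0.
have := bernoulli_tail (primitives_indep hI) S (eta I t + e) l0.
have <- : eta I t = \sum_i fine (P (primitives i @^-1` S i)).
  rewrite /eta big_sumType/= [X in _ = X + _]big1 ?add0r.
    rewrite big_mkcond/=; apply: eq_bigr => b _; rewrite -/(relevant t b).
    case: ifPn => hb.
      by congr (fine (P _)); apply/seteqP; split => w /= => [[]|[_ []]].
    rewrite (_ : _ @^-1` _ = set0) ?measure0//.
    by apply/seteqP; split => w //= -[].
  by case=> s th _; rewrite preimage_set0 measure0.
have mb : measurable (bad_perishing t).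
  apply: (measurable_determined (X := @primitives R I)) => w w' h.
  by rewrite /bad_perishing/= !perish_countE; under eq_bigr do rewrite h.
move=> H; apply: le_trans (le_trans _ H) _.
  apply: le_measure; rewrite ?inE//.
    apply: (measurable_determined (X := @primitives R I)) => w w' h /=.
    by under eq_bigr do rewrite h.
  by move=> w; rewrite /bad_perishing/= perish_countE => /ltW.
rewrite lee_fin -expR_logP// ler_expR.
(* l is the value at which the Pade bound reads eta * expR l <= eta + e. *)
have hpade : eta I t * expR l <= eta I t + e.
  have := @expR_le_pade R l (ltW l0).
  have -> : 2 - l = 4 * eta I t / (2 * eta I t + e).
    by rewrite /l; field; rewrite gt_eqF.
  have -> : 2 + l = 4 * (eta I t + e) / (2 * eta I t + e).
    by rewrite /l; field; rewrite gt_eqF.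
  rewrite mulrAC ler_pM2r ?invr_gt0// -mulrA ler_pM2l//.
have lE : logP t = e ^+ 2 / (2 * eta I t + e) by rewrite eE mulfK// gt_eqF.
have -> : - logP t = e - l * (eta I t + e).
  by rewrite lE /l; field; rewrite gt_eqF.
by rewrite addrC lerD2r; lra.
Qed.

Lemma measurable_good : measurable [set w | good w].
Proof.
apply: (measurable_determined (X := @primitives R I)) => w w' h [g1 g2 g3].
split => [t th tT|t t' tt'|t tT].
- move: (tT) (g1 t th tT); case: t tT => // t; rewrite ltnS /= => tT _.
  by have := h (inl (Ordinal tT, th)) => /= ->.
- have /andP[_ t'T] := tt'; have := g2 _ _ tt'; rewrite !arrivals_devE//.
  by under eq_bigr do rewrite h.
- by have := g3 _ tT; rewrite !perish_countE; under eq_bigr do rewrite h.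
Qed.

Lemma probability_good : ((1 - 2 * d)%:E <= P [set w | good w])%E.
Proof.
have mg := measurable_good.
have T0 : 0 < T%:R :> R by rewrite ltr0n; exact: horizon_gt0 lnT1.
(* The pair [p] encodes the nonempty window [(p.1, p.1 + p.2 + 1]]; there are at most [T^2] of them,
   at cost [d / T^2] each. *)
pose BA := \big[setU/set0]_(p : 'I_T * 'I_T | (p.1 + p.2 < T)%N)
   bad_arrivals (I := I) p.1 (p.1 + p.2).+1.
pose BP := \big[setU/set0]_(t < T) bad_perishing t.+1.
have mBA (p : 'I_T * 'I_T) : (p.1 + p.2 < T)%N ->
    measurable (bad_arrivals (I := I) p.1 (p.1 + p.2).+1).
  move=> pT; apply: (measurable_determined (X := @primitives R I)) => w w' h.
  by rewrite /bad_arrivals/= !arrivals_devE//; under eq_bigr do rewrite h.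
have mBP t : measurable (bad_perishing t).
  apply: (measurable_determined (X := @primitives R I)) => w w' h.
  by rewrite /bad_perishing/= !perish_countE; under eq_bigr do rewrite h.
have PBA : (P BA <= d%:E)%E.
  apply: le_trans; first exact: probability_bigsetU_le.
  apply: (@le_trans _ _ (\sum_(p : 'I_T * 'I_T) (d / T%:R ^+ 2)%:E)%E).
    rewrite [leLHS]big_mkcond/=; apply: lee_sum => p _; case: ifP => pT.
      by apply: bad_arrivals_le => //; lia.
    by rewrite lee_fin divr_ge0 ?exprn_ge0 ?ltW.
  rewrite sumEFin lee_fin sumr_const card_prod card_ord -[leLHS]mulr_natr natrM.
  by rewrite le_eqVlt; apply/orP; left; apply/eqP; field; rewrite gt_eqF.
have PBP : (P BP <= d%:E)%E.
  apply: le_trans; first exact: probability_bigsetU_le.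
  apply: (@le_trans _ _ (\sum_(t < T) (d / (3 * t.+1%:R * ln T%:R))%:E)%E).
    by apply: lee_sum => t _; exact: bad_perishing_le.
  rewrite sumEFin lee_fin.
  have := harmonic_le_ln R (horizon_gt0 lnT1).
  rewrite big_add1/= big_mkord => H.
  have -> : \sum_(t < T) d / (3 * t.+1%:R * ln T%:R) =
      (d / (3 * ln T%:R)) * \sum_(t < T) (t.+1%:R)^-1.
    by rewrite mulr_sumr; apply: eq_bigr => t _; rewrite !invfM; ring.
  (* The factor 3 in [confP] absorbs the harmonic sum: [1 + ln T <= 3 ln T] as [ln T >= 1]. *)
  have h : d / (3 * ln T%:R) * (1 + ln T%:R) <= d.
    rewrite mulrAC ler_pdivrMr; last by rewrite mulr_gt0// (lt_le_trans _ lnT1).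
    by rewrite ler_pM2l//; move: (ln _) lnT1 => a a1; lra.
  apply: le_trans h; apply: ler_wpM2l H.
  by rewrite divr_ge0 ?mulr_ge0// ?(le_trans _ lnT1)// ltW.
have mA : measurable BA by apply: bigsetU_measurable.
have mP : measurable BP by apply: bigsetU_measurable.
have : (P (~` [set w | good w]) <= P (BA `|` BP))%E.
  apply: le_probability_ae; [exact: measurableC|exact: measurableU|].
  have : {ae P, forall w, forall i : 'I_T * Theta I,
      (1 <= arrival I i.1.+1 i.2 w)%N}.
    apply: filter_forall => -[s th] /=; apply: (arrival_ge1 hI); exact: ltn_ord.
  apply: filterS => w h; apply: contra_notP => /not_orP[nA nP].
  split => [t th tT|t t' /andP[tt' t'T]|t /andP[t1 tT]].
  - by case: t tT => // t tT; have := h (Ordinal tT, th).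
  (* Empty windows are not in the union; their deviation is 0. *)
  - move: tt'; rewrite leq_eqVlt => /orP[/eqP ->|tt'].
      rewrite arrivals_devE// big_pred0 ?normr0 ?sqrtr_ge0// => -[[s th]|b]//=.
      by lia.
    rewrite leNgt; apply/negP => bad; apply: nA.
    have tT : (t < T)%N by lia.
    have kT : (t' - t.+1 < T)%N by lia.
    rewrite /BA (bigD1 (Ordinal tT, Ordinal kT)) /=; last by lia.
    by left; rewrite /bad_arrivals /= (_ : (t + (t' - t.+1)).+1 = t')//; lia.
  - rewrite leNgt; apply/negP => bad; apply: nP.
    have tT' : (t.-1 < T)%N by lia.
    by rewrite /BP (bigD1 (Ordinal tT'))//=; left; rewrite prednK.
rewrite probability_setC// => H.
have {}H := le_trans H (le_trans (measureU2 _ mA mP) (leeD PBA PBP)).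
move: H; rewrite -[P _]fineK ?fin_num_measure//.
move: (fine _) => g; rewrite -!EFinD !lee_fin => h; lra.
Qed.
End GoodPerishing.

(** * Sample paths *)

Section ScheduleOrder.
Variables (R : realType) (I : instance R).
Local Notation unit_ := 'I_(nunits I).
Implicit Types (u : unit_ -> R) (a : R) (b : unit_).

(** Allows induction on the rank although the schedule is an arbitrary permutation. *)
Lemma rank_leS (r : nat) : (r < nunits I)%N -> exists b0 : unit_,
  rank b0 = r.+1 /\ forall b, (rank b <= r.+1)%N && (b != b0) = (rank b <= r)%N.
Proof.
move=> rB; exists ((schedule I)^-1%g (Ordinal rB)).
have rk0 : rank ((schedule I)^-1%g (Ordinal rB)) = r.+1 by rewrite /rank permKV.
split => // b; rewrite leq_eqVlt andb_orl.
have -> : (rank b == r.+1) = (b == (schedule I)^-1%g (Ordinal rB)).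
  apply/eqP/eqP => [|-> //]; rewrite -rk0 => -[] /val_inj.
  exact: perm_inj.
rewrite andbN/= ltnS; case: (leqP (rank b) r) => //= rb; rewrite ?andbF//.
by apply/eqP => bE; move: rb; rewrite bE rk0 ltnn.
Qed.

Lemma rank_max b : (rank b <= nunits I)%N.
Proof. exact: ltn_ord. Qed.

Lemma taken_ge0 u a b : (forall b, 0 <= u b) -> 0 <= taken u a b.
Proof. by move=> u0; rewrite /taken le_min u0 le_max lexx. Qed.

Lemma taken_le u a b : taken u a b <= u b.
Proof. by rewrite /taken ge_min lexx. Qed.

(** The handout is greedy: the unit of rank [r + 1] contributes to what is left of [a] once the
    first [r] ranks are exhausted. *)
Lemma sum_taken_prefix u a (r : nat) : (forall b, 0 <= u b) -> 0 <= a ->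
  \sum_(b | (rank b <= r)%N) taken u a b =
  Num.min (\sum_(b | (rank b <= r)%N) u b) a.
Proof.
move=> u0 a0; elim: r => [|r IH].
  by rewrite !big_pred0//; apply/esym/min_idPl.
have [rB|rB] := ltnP r (nunits I); last first.
  have eqr b : (rank b <= r.+1)%N = (rank b <= r)%N.
    by have := rank_max b; lia.
  by rewrite !(eq_bigl _ _ eqr).
have [b0 [rk0 eqr]] := rank_leS rB.
rewrite (bigD1 b0) ?rk0//= [in RHS](bigD1 b0) ?rk0//= !(eq_bigl _ _ eqr) IH.
rewrite /taken rk0.
rewrite (eq_bigl (fun b => (rank b <= r)%N))//.
have S0 : 0 <= \sum_(b | (rank b <= r)%N) u b by apply: sumr_ge0.
move: (\sum_(b | _) _) S0 (u0 b0) => S S0; move: (u b0) => ub ub0.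
rewrite /Order.min /Order.max; repeat case: ifPn; rewrite -?leNgt => *; lra.
Qed.

Lemma sum_taken u a : (forall b, 0 <= u b) -> 0 <= a ->
  \sum_b taken u a b = Num.min (\sum_b u b) a.
Proof.
move=> u0 a0; have := sum_taken_prefix (nunits I) u0 a0.
have eqT (b : unit_) : (rank b <= nunits I)%N = true by exact: rank_max.
by rewrite !(eq_bigl _ _ eqT).
Qed.

End ScheduleOrder.

(** * Invariants of a run, then its analysis on the good event *)

Section SamplePath.
Variables (R : realType) (I : instance R) (w : Omega I).
Local Notation T := (horizon I).
Local Notation B := ((nunits I)%:R : R).
Local Notation X := (X_low I).
Local Notation L := (envy I).
Local Notation unit_ := 'I_(nunits I).
Hypothesis X_ge0 : 0 <= X.
Hypothesis L_ge0 : 0 <= L.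
Hypothesis P_bar_ge0 : forall t, 0 <= P_bar I t.
Hypothesis upN_ge0 : forall t, 0 <= upN I t T.

Local Notation u t := (leftover (run w t)).
Local Notation bt t := (budget (run w t)).
Local Notation nt t := ((arrivals_at t w)%:R : R).

Definition rate (t : nat) : R := guardrail t w (bt t.-1).
Definition given (t : nat) : R := nt t * rate t.
Definition unspoiled (t : nat) (b : unit_) : R :=
  u t.-1 b - taken (u t.-1) (given t) b.
Definition perished (t : nat) : R :=
  \sum_(b : unit_ | perishing I b w == t) unspoiled t b.

Lemma sum_given t x :
  \sum_(th : Theta I) (arrival I t th w)%:R * x = nt t * x.
Proof. by rewrite -mulr_suml /arrivals_at natr_sum. Qed.

Lemma budgetS t : bt t.+1 = bt t - given t.+1 - perished t.+1.
Proof.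
by rewrite /= sum_given /perished /unspoiled /given /rate /=.
Qed.

Lemma leftoverS t b :
  u t.+1 b = if perishing I b w == t.+1 then 0 else unspoiled t.+1 b.
Proof. by rewrite /= sum_given. Qed.

Lemma guardrail_bounds t b : 0 <= b ->
  0 <= guardrail t w b /\ nt t * guardrail t w b <= b.
Proof.
move=> b0; rewrite /guardrail; case: ifPn => [bX|]; last rewrite -leNgt => bX.
  split; first by rewrite divr_ge0.
  have [n0|n0] := eqVneq (nt t) 0; first by move: bX; rewrite n0 mul0r ltNge b0.
  by rewrite mulrCA divff// mulr1.
case: ifPn => // h; split; first by rewrite addr_ge0.
rewrite -subr_ge0; apply: le_trans h.
by rewrite addr_ge0 ?mulr_ge0.
Qed.

Definition sum_to (f : nat -> R) (t : nat) : R := \sum_(1 <= s < t.+1) f s.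

Lemma sum_toS f t : sum_to f t.+1 = sum_to f t + f t.+1.
Proof. by rewrite /sum_to big_nat_recr. Qed.

(** The last clause records the schedule order: anything handed out came from the lowest available
    ranks, so the first [r] ranks retain at most [r] minus the cumulative allocation, spoilage only
    lowering this. *)
Definition start_invariant (t : nat) : Prop :=
  [/\ forall b, 0 <= u t b <= 1, \sum_b u t b = bt t &
      forall r, \sum_(b : unit_ | (rank b <= r)%N) u t b <=
        Num.max 0 (r%:R - sum_to given t)].

(** The same facts inside round [t + 1], after its allocation and before its spoilage. *)
Definition handout_invariant (t : nat) : Prop :=
  [/\ 0 <= given t.+1, given t.+1 <= bt t,
      forall b, 0 <= unspoiled t.+1 b <= 1,
      \sum_b unspoiled t.+1 b = bt t - given t.+1 &
      forall r, \sum_(b : unit_ | (rank b <= r)%N) unspoiled t.+1 b <=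
        Num.max 0 (r%:R - sum_to given t.+1)].

Lemma handout_of_start t : start_invariant t -> handout_invariant t.
Proof.
case=> u01 ub ur.
have u0 b : 0 <= u t b by case/andP: (u01 b).
have b0 : 0 <= bt t by rewrite -ub sumr_ge0.
have [g0 gb] := guardrail_bounds t.+1 b0.
have gv0 : 0 <= given t.+1 by rewrite mulr_ge0.
split => //.
- move=> b; rewrite /unspoiled subr_ge0 taken_le/=.
  have /andP[_ u1] := u01 b; apply: le_trans u1.
  by rewrite lerBlDr lerDl taken_ge0.
- by rewrite sumrB sum_taken// ub; congr (_ - _); apply/min_idPr.
move=> r; rewrite sumrB sum_taken_prefix// sum_toS.
have := ur r; move: (sum_to _ _) (given _) gv0 => A g g0'.
move: (\sum_(b | _) _) => S.
by rewrite /Order.min /Order.max; repeat case: ifPn; rewrite -?leNgt => *; lra.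
Qed.

Lemma run_start t : start_invariant t.
Proof.
elim: t => [|t /handout_of_start[g0 gb v01 vb vr]].
  split => [b||r]; first by rewrite /= ler01 lexx.
    by rewrite /= sumr_const card_ord.
  rewrite /sum_to big_geq// subr0 le_max; apply/orP; right.
  elim: r => [|r IH]; first by rewrite big_pred0.
  have [rB|rB] := ltnP r (nunits I); last first.
    have eqr (b : unit_) : (rank b <= r.+1)%N = (rank b <= r)%N.
      by have := rank_max b; lia.
    by rewrite (eq_bigl _ _ eqr) (le_trans IH)// ler_nat.
  have [b0 [rk0 eqr]] := rank_leS rB.
  rewrite (bigD1 b0) ?rk0//= (eq_bigl _ _ eqr).
  by rewrite -[r.+1%:R]natr1 addrC lerD2r.
split.
- by move=> b; rewrite leftoverS; case: ifP => // _; rewrite lexx ler01.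
- rewrite budgetS -vb /perished.
  rewrite [in RHS](bigID (fun b => perishing I b w == t.+1)).
  rewrite addrAC subrr add0r [RHS]big_mkcond; apply: eq_bigr => b _.
  by rewrite leftoverS; case: ifP.
move=> r; apply: le_trans (vr r); apply: ler_sum => b _; rewrite leftoverS.
by case: ifP => // _; case/andP: (v01 b).
Qed.

Lemma run_handout t : handout_invariant t.
Proof. exact: handout_of_start (run_start t). Qed.

Lemma given_ge0 t : 0 <= given t.+1.
Proof. by case: (run_handout t). Qed.

Lemma sum_to_mono s t : (s <= t)%N -> sum_to given s <= sum_to given t.
Proof.
move/subnK <-; elim: (t - s)%N => [|k IH]; first by rewrite add0n.
by rewrite addSn sum_toS (le_trans IH)// lerDl given_ge0.
Qed.

(** The prefix bound at [r = rank b] is then 0, and the prefix contains [b]. *)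
Lemma unspoiled_eq0 t b : (0 < t)%N -> (rank b)%:R <= sum_to given t ->
  unspoiled t b = 0.
Proof.
case: t => // t _ rA; have [_ _ v01 _ vr] := run_handout t.
apply: le_anti; case/andP: (v01 b) => -> _; rewrite andbT.
apply: le_trans (le_trans (vr (rank b)) _).
  rewrite (bigD1 b)//= lerDl sumr_ge0// => b' _; by case/andP: (v01 b').
by rewrite ge_max lexx subr_le0.
Qed.

Lemma budgetE t : bt t = B - sum_to given t - sum_to perished t.
Proof.
elim: t => [|t IH]; first by rewrite /sum_to !big_geq//= !subr0.
by rewrite budgetS IH !sum_toS; ring.
Qed.

Definition perished_in (s t : nat) : R := \sum_(s <= r < t.+1) perished r.

(** After exchanging the sums, each unit appears only in its own perishing round, and there with at
    most 1. *)
Lemma perished_in_le (Q : pred unit_) (s t : nat) : (0 < s)%N ->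
  (forall b, (s <= perishing I b w <= t)%N ->
     unspoiled (perishing I b w) b != 0 -> Q b) ->
  perished_in s t <= \sum_(b | Q b) 1.
Proof.
move=> s0 HQ; rewrite /perished_in /perished (exchange_big_dep xpredT)//=.
rewrite [leRHS]big_mkcond/=; apply: ler_sum => b _.
rewrite (eq_bigl (fun r => r == perishing I b w));
  last by move=> r; rewrite eq_sym.
rewrite big_nat1_eq ltnS; case: ifPn => [st|_]; last by case: ifP.
have [->|nz] := eqVneq (unspoiled (perishing I b w) b) 0; first by case: ifP.
rewrite HQ//.
have [p0 _] := andP st; have := leq_trans s0 p0.
case: (perishing I b w) => // p _.
by have [_ _ v01 _ _] := run_handout p; case/andP: (v01 b).
Qed.

Hypothesis hI : standing I.
Hypothesis lnT1 : 1 <= ln (T%:R : R).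
Hypothesis gw : good w.
Local Notation N t t' := ((arrivals t t' w)%:R : R).

Lemma lowN_le t t' : (t <= t' <= T)%N -> lowN I t t' <= N t t' <= upN I t t'.
Proof.
move=> tt'; case: gw => _ /(_ _ _ tt') + _; rewrite ler_norml /lowN /upN.
by move=> /andP[h1 h2]; apply/andP; split; lra.
Qed.

Lemma arrivals_cat s t t' : (s <= t <= t')%N -> N s t' = N s t + N t t'.
Proof.
move=> /andP[st tt']; rewrite -natrD /arrivals.
by rewrite (@big_cat_nat _ _ _ t.+1).
Qed.

Lemma arrivals1 t : N t t.+1 = nt t.+1.
Proof. by rewrite /arrivals big_nat1. Qed.

Lemma arrivals00 t : N t t = 0.
Proof. by rewrite /arrivals big_geq. Qed.

Lemma given_ge t : (forall s, (1 <= s <= t)%N -> X <= rate s) ->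
  N 0 t * X <= sum_to given t.
Proof.
elim: t => [|t IH] H; first by rewrite arrivals00 mul0r /sum_to big_geq.
rewrite (@arrivals_cat 0 t); last by lia.
rewrite arrivals1 mulrDl sum_toS lerD//.
  by apply: IH => s /andP[s1 st]; apply: H; rewrite s1 leqW.
by apply: ler_wpM2l => //; apply: H; rewrite leqnn.
Qed.

(** A unit of which something spoils has rank above the cumulative allocation up to its perishing
    round. With rates at least [X], that allocation dominates the forecast [lowN] times [X], so the
    unit is relevant and perishes before [tau]; [t < T] supplies the other half of the minimum. *)
Lemma perished_in_le_count r s t : (1 <= r <= s)%N -> (t < T)%N ->
  (forall q, (1 <= q <= t)%N -> X <= rate q) ->
  perished_in s t <= perish_count r w.
Proof.
move=> /andP[r1 rs] tT Hx.
have gv q : (q <= t)%N -> N 0 q * X <= sum_to given q.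
  move=> qt; apply: given_ge => s' /andP[s1 s't].
  by apply: Hx; rewrite s1 (leq_trans s't).
rewrite /perish_count.
have -> : \sum_(b | relevant r b)
     (`[< perish_event r b (perishing I b w) >]%:R : R) =
   \sum_(b | relevant r b && `[< perish_event r b (perishing I b w) >]) 1.
  rewrite big_mkcondr/=; apply: eq_bigr => b _; by case: asbool.
apply: perished_in_le; first exact: leq_trans rs.
move=> b /andP[sp pt] nz.
have p0 : (0 < perishing I b w)%N by rewrite (leq_trans _ sp)// (leq_trans r1).
have ngiven q : (q <= perishing I b w)%N -> sum_to given q < (rank b)%:R.
  move=> qp; rewrite ltNge; apply/negP => rA; move/eqP: nz; apply.
  by apply: unspoiled_eq0 => //; apply: le_trans rA (sum_to_mono qp).
apply/andP; split.
  rewrite /relevant ceil_le_int leNgt; apply/negP => h.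
  have r1p : (r.-1 <= perishing I b w)%N by lia.
  have := ngiven _ r1p; rewrite ltNge => /negP; apply.
  apply: le_trans (gv r.-1 _); last by lia.
  apply: ltW; apply: lt_le_trans h _; apply: ler_wpM2r => //.
  by have /andP[] := @lowN_le 0 r.-1 ltac:(lia).
apply/asboolP; split; first exact: leq_trans rs sp.
rewrite lt_min lte_fin ltr_nat (leq_ltn_trans pt tT)/=.
(* The infimum may be over an empty set; bounding it below by the next integer gives the strict
   inequality in every case. *)
apply: (@lt_le_trans _ _ ((perishing I b w).+1%:R)%:E).
  by rewrite lte_fin ltr_nat.
apply/ereal_infP => _ [t' /= [/andP[rt' t'T] rl] <-].
rewrite lee_fin ler_nat ltnNge; apply/negP => t'p.
have := ngiven _ t'p; rewrite ltNge => /negP; apply.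
apply: le_trans (gv t' (leq_trans t'p pt)).
apply: le_trans rl _; rewrite -mulrDl; apply: ler_wpM2r => //.
rewrite (@arrivals_cat 0 r.-1); last by lia.
apply: lerD.
  by have /andP[] := @lowN_le 0 r.-1 ltac:(lia).
by have /andP[] := @lowN_le r.-1 t' ltac:(lia).
Qed.

(** [P_bar s] is a running minimum, so every earlier round [r <= s] must supply a bound; index 0 is
    the trivial bound by the number of units. *)
Lemma perished_in_le_P_bar s t : (1 <= s <= T)%N -> (t < T)%N ->
  (forall q, (1 <= q <= t)%N -> X <= rate q) ->
  perished_in s t <= P_bar I s.
Proof.
move=> /andP[s1 sT] tT Hx.
have : forall r, (r <= s)%N -> perished_in s t <= P_bar I r; last by apply.
elim=> [_|r IH rs] /=.
  apply: le_trans (perished_in_le (Q := xpredT) s1 _) _ => //.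
  by rewrite sumr_const card_ord.
rewrite le_min IH ?(ltnW rs)//=.
apply: le_trans (perished_in_le_count (r := r.+1) _ tT Hx) _.
  by rewrite rs.
by case: gw => _ _; apply; rewrite (leq_trans rs).
Qed.

Hypothesis P_bar1_le : P_bar I 1 <= B - X * upN I 0 T.

Let T_gt0 : (0 < T)%N. Proof. exact: horizon_gt0 lnT1. Qed.

(* The anchor s is the last round that handed out X_high (0 if none has): its
   threshold test reserved X_low for all later arrivals plus P_bar s. *)
Definition anchored (t : nat) : Prop :=
  (forall q, (1 <= q <= t)%N -> X <= rate q) /\
  exists2 s, (s <= t)%N & X * upN I s T + P_bar I (maxn s 1)
    - perished_in (maxn s 1) t - N s t * X <= bt t.

(** The reserve [X * upN s T] covers all arrivals after [s] at rate [X], and [P_bar] covers the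
    spoilage since the anchor. Removing the arrivals in [(s, t]] leaves enough for those in round
    [t + 1]. *)
Lemma anchored_affordable t : (t < T)%N -> anchored t -> nt t.+1 * X <= bt t.
Proof.
move=> tT [Hx [s st hs]]; apply: le_trans hs.
have s1T : (1 <= maxn s 1 <= T)%N by lia.
have := perished_in_le_P_bar s1T tT Hx.
have /andP[_] := @lowN_le s T ltac:(lia).
rewrite (@arrivals_cat s t T); last by lia.
rewrite (@arrivals_cat t t.+1 T); last by lia.
rewrite arrivals1 => h1 h2.
have := ler_wpM2l X_ge0 h1.
have : 0 <= X * N t.+1 T by rewrite mulr_ge0.
nra.
Qed.

Lemma rate_cases t : nt t.+1 * X <= bt t ->
  (rate t.+1 = X_high I /\
     X * upN I t.+1 T + P_bar I t.+1 <= bt t - nt t.+1 * X_high I) \/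
  (rate t.+1 = X /\
     bt t - nt t.+1 * X_high I < X * upN I t.+1 T + P_bar I t.+1).
Proof.
move=> aff; rewrite /rate /guardrail /= ltNge aff /=.
by case: ifPn => [h|]; [left|rewrite -ltNge => h; right].
Qed.

Lemma anchoredP t : (t <= T)%N -> anchored t.
Proof.
elim: t => [_|t IH tT].
  split=> [q|]; first by lia.
  (* At the start the reserve is available by the feasibility of [X_low], through [P_bar1_le];
     [maxn] replaces the anchor 0 by round 1. *)
  exists 0%N => //; rewrite /perished_in big_geq// arrivals00 mul0r !subr0/=.
  by rewrite addrC -lerBrDr.
have ih := IH (ltnW tT); have aff := anchored_affordable tT ih.
have [Hx [s st hs]] := ih.
have Hx' : X <= rate t.+1 -> forall q, (1 <= q <= t.+1)%N -> X <= rate q.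
  move=> h q /andP[q1]; rewrite leq_eqVlt => /orP[/eqP -> //|qt].
  by apply: Hx; rewrite q1.
(* A round at [X_high] moves the anchor to itself, its passed test being the new reserve; a round at
   [X] keeps the old anchor. *)
have [[rE h]|[rE h]] := rate_cases aff.
  split; first by apply: Hx'; rewrite rE lerDl.
  exists t.+1 => //; rewrite budgetS /given rE arrivals00 mul0r subr0.
  by rewrite (maxn_idPl _)// /perished_in big_nat1; lra.
split; first by apply: Hx'; rewrite rE.
exists s; first exact: leqW.
rewrite budgetS /given rE (@arrivals_cat s t); last by lia.
rewrite arrivals1 /perished_in big_nat_recr/=; last by lia.
by move: hs; rewrite /perished_in; lra.
Qed.

Lemma rate_between t : (1 <= t <= T)%N -> X <= rate t <= X_high I.
Proof.
case: t => // t /andP[_ tT].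
have aff := anchored_affordable tT (anchoredP (ltnW tT)).
have [[-> _]|[-> _]] := rate_cases aff.
  by rewrite lexx lerDl L_ge0.
by rewrite lexx lerDl L_ge0.
Qed.

(** All rounds after [t0] hand out [X_high]; [t0 = 0] means that no round failed the test. *)
Lemma last_low_round t : (t <= T)%N -> exists t0,
  [/\ (t0 <= t)%N, sum_to given t0 + N t0 t * X_high I <= sum_to given t &
   t0 = 0%N \/ [/\ (0 < t0)%N, rate t0 = X &
     bt t0.-1 - nt t0 * X_high I < X * upN I t0 T + P_bar I t0]].
Proof.
elim: t => [_|t IH tT].
  by exists 0%N; split => //; [rewrite arrivals00 mul0r addr0|left].
have aff := anchored_affordable tT (anchoredP (ltnW tT)).
have [[rE h]|[rE h]] := rate_cases aff.
  have [t0 [t0t ht0 ht0']] := IH (ltnW tT).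
  exists t0; split => //; first exact: leqW.
  rewrite (@arrivals_cat t0 t); last by lia.
  by rewrite arrivals1 sum_toS [given t.+1]/given rE; lra.
by exists t.+1; split => //; [rewrite arrivals00 mul0r addr0|right].
Qed.

Lemma P_bar_le_P_bar1 t : (0 < t)%N -> P_bar I t <= P_bar I 1.
Proof.
case: t => // t _; elim: t => [|t IH]; first exact: lexx.
by apply: le_trans IH; rewrite [leLHS]/= ge_min lexx.
Qed.

(** The failed test at [t0] bounds the budget from above, hence the earlier allocation from below.
    Both the spoilage before [t0] and the forecast [P_bar t0] are at most [P_bar 1], whence the
    factor 2; the first term is the excess [X_high - X] withheld in round [t0] itself. *)
Lemma sum_to_given_ge : exists2 t0, (t0 <= T)%N &
  B - sum_to given T <= N t0.-1 t0 * L + X * (upN I t0 T - N t0 T) - N t0 T * L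
    + 2 * (B - X * upN I 0 T).
Proof.
have [t0 [t0T h0 h1]] := last_low_round (leqnn T); exists t0 => //.
have D0 := le_trans (P_bar_ge0 1) P_bar1_le.
case: h1 => [t00|[]].
  move: h0; rewrite t00 arrivals00 /sum_to [X in X + _]big_geq// /X_high; lra.
case: t0 t0T h0 => // t0 t0T h0 _ rE.
rewrite !succnK budgetE => h2.
have h3 : sum_to perished t0 <= P_bar I 1.
  apply: perished_in_le_P_bar => // q /andP[q1 qt].
  by have /andP[] := rate_between (t := q) ltac:(lia).
have h4 := P_bar_le_P_bar1 (ltn0Sn t0).
move: h0; rewrite sum_toS [given t0.+1]/given rE arrivals1.
move: h2 h3 h4 P_bar1_le; rewrite /X_high.
move: (P_bar I 1) (P_bar I t0.+1) (sum_to given t0) (sum_to perished t0)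
  (sum_to given T) (upN I t0.+1 T) (upN I 0 T) (nt t0.+1) (N t0.+1 T)
  => p1 p g s gT u1 u0 n n1.
by move=> *; lra.
Qed.

Lemma X_algE t th : X_alg t th w = rate t. Proof. by []. Qed.

Lemma Delta_efficiencyE : Delta_efficiency I w = B - sum_to given T.
Proof.
congr (_ - _); apply: eq_bigr => t _.
by under eq_bigr do rewrite X_algE; rewrite sum_given.
Qed.

End SamplePath.

(** * Initial forecasts and feasibility of the lower rate *)

Section Forecasts.
Variables (R : realType) (I : instance R).
Local Notation T := (horizon I).
Local Notation B := ((nunits I)%:R : R).
Local Notation X := (X_low I).
Hypothesis hI : standing I.
Hypothesis lnT1 : 1 <= ln (T%:R : R).

Lemma P_bar_ge0 t : 0 <= P_bar I t.
Proof.
elim: t => [|t IH]; first exact: ler0n.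
by rewrite /= le_min IH/= addr_ge0 ?eta_ge0// ltW// confP_gt0 ?eta_ge0.
Qed.

Lemma mean_arrivals_ge0 t t' : 0 <= mean_arrivals I t t'.
Proof. by apply: fine_ge0; apply: expectation_ge0 => w; exact: ler0n. Qed.

Lemma upN_ge0 t t' : 0 <= upN I t t'.
Proof. by rewrite addr_ge0 ?mean_arrivals_ge0 ?sqrtr_ge0. Qed.

Lemma lowN00 : lowN I 0 0 = 0.
Proof.
rewrite /lowN mean_arrivalsE// big_geq// /confN subnn mulr0 !mul0r.
by rewrite sqrtr0 subr0.
Qed.

(** In round 1 no rank is excluded because [lowN 0 0 = 0], and perishing times are at least 1; so
    [eta 1] is the [mu] through which [X_low] is defined. *)
Lemma P_bar1E : P_bar I 1 = Delta_bar I X.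
Proof.
rewrite /= /Delta_bar; suff -> : eta I 1 = mu I X by [].
rewrite /eta /mu; apply: eq_big => [b|b _].
  by rewrite /= lowN00 mul0r ceil0.
congr (fine (prob I _)); apply/seteqP; split => w /= [] //.
by split => //; exact: perishing_ge1.
Qed.

Lemma P_bar1_le : 0 < upN I 0 T -> P_bar I 1 <= B - X * upN I 0 T.
Proof.
move=> u0; rewrite P_bar1E; case: (X_low_attained hI) => _.
by rewrite ler_pdivlMr// lerBrDl addrC -lerBrDl.
Qed.

End Forecasts.

(** * Asymptotic bounds *)

Section Determined.
Variables (R : realType) (I : instance R) (w w' : Omega I).
Local Notation T := (horizon I).
Hypothesis same : forall i, @primitives R I i w = primitives i w'.

Lemma arrival_ext t th : (1 <= t <= T)%N ->
  arrival I t th w = arrival I t th w'.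
Proof.
case: t => // t /andP[_ tT].
exact: (same (inl (Ordinal tT, th))).
Qed.

Lemma arrivals_at_ext t : (1 <= t <= T)%N -> arrivals_at t w = arrivals_at t w'.
Proof. by move=> tT; apply: eq_bigr => th _; rewrite arrival_ext. Qed.

Lemma guardrail_ext t b : (1 <= t <= T)%N -> guardrail t w b = guardrail t w' b.
Proof. by move=> tT; rewrite /guardrail arrivals_at_ext. Qed.

Lemma perishing_ext b : perishing I b w = perishing I b w'.
Proof. exact: (same (inr b)). Qed.

Lemma run_ext t : (t <= T)%N -> run w t = run w' t.
Proof.
elim: t => // t IH tT /=; rewrite -IH ?(ltnW tT)// /round guardrail_ext//.
under eq_bigr do rewrite arrival_ext//.
congr State.
  by congr (_ - _); apply: eq_bigl => b; rewrite perishing_ext.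
by apply/funext => b; rewrite perishing_ext.
Qed.

Lemma X_alg_ext t th : (1 <= t <= T)%N -> X_alg t th w = X_alg t th w'.
Proof. by move=> tT; rewrite /X_alg run_ext ?guardrail_ext//; lia. Qed.

Lemma arrivals_total_ext : arrivals_total w = arrivals_total w'.
Proof.
apply: eq_big_nat => t tT; apply: eq_bigr => th _; rewrite arrival_ext//; lia.
Qed.

Lemma Delta_EF_ext : Delta_EF I w = Delta_EF I w'.
Proof.
apply: eq_big_nat => t tT; apply: eq_bigr => th _.
by rewrite arrivals_total_ext X_alg_ext//; lia.
Qed.

Lemma Delta_efficiency_ext : Delta_efficiency I w = Delta_efficiency I w'.
Proof.
congr (_ - _); apply: eq_big_nat => t tT; apply: eq_bigr => th _.
by rewrite arrival_ext ?X_alg_ext//; lia.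
Qed.

End Determined.

(** * Explicit bounds for one instance in a single scale [Z] *)

Section Bounds.
Variables (R : realType) (I : instance R) (Z : R).
Local Notation T := (horizon I).
Local Notation P := (prob I).
Local Notation B := ((nunits I)%:R : R).
Local Notation X := (X_low I).
Local Notation L := (envy I).
Local Notation n := (#|Theta I|%:R : R).
Hypothesis hI : standing I.
Hypothesis lnT1 : 1 <= ln (T%:R : R).
Hypothesis mean_gt0 : 0 < mean_total I.
Hypothesis L_gt0 : 0 < L.
Hypothesis L_le1 : L <= 1.
Hypothesis Z_ge1 : 1 <= Z.
Hypothesis beta_le : beta_avg I <= Z.
Hypothesis n_le : n <= Z.
Hypothesis util_le : util_max I <= Z.
Hypothesis mu_le : mu_max I <= Z.
Hypothesis rho_le : rho_max I <= Z.
Hypothesis lnT_le : ln (T%:R : R) <= Z.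
Hypothesis lnd_le : ln (delta I)^-1 <= Z.

Let Z_ge0 : 0 <= Z. Proof. exact: le_trans Z_ge1. Qed.
Let T_gt0 : (0 < T)%N. Proof. exact: horizon_gt0 lnT1. Qed.

Lemma rho_max_ge0 : 0 <= rho_max I.
Proof. exact: bigmax_ge_id. Qed.

(** The logarithm is at most [4 Z] and the other parameters contribute [2 Z^3], so the radicand is
    at most [8 Z^4 (t' - t)]; 8 is rounded up to the square 9. *)
Lemma confN_le t t' : confN I t t' <= 3 * Z ^+ 2 * Num.sqrt (t' - t)%N%:R.
Proof.
have z0 : 0 <= 3 * Z ^+ 2 by rewrite mulr_ge0// exprn_ge0.
have -> : 3 * Z ^+ 2 = Num.sqrt ((3 * Z ^+ 2) ^+ 2).
  by rewrite sqrtr_sqr ger0_norm.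
rewrite -sqrtrM ?sqr_ge0// ler_sqrt ?mulr_ge0 ?sqr_ge0//.
have /andP[d0 d1] := delta_range hI.
have Tp : 0 < T%:R :> R by rewrite ltr0n.
have -> : ln (2 * T%:R ^+ 2 / delta I) =
    ln 2 + 2 * ln (T%:R : R) + ln (delta I)^-1.
  rewrite !lnM ?posrE ?mulr_gt0 ?exprn_gt0 ?invr_gt0//.
  by ring.
have ln2 : ln (2 : R) <= Z.
  apply: le_trans Z_ge1; have := @le_ln1Dx R 1; apply; lra.
have h : ln 2 + 2 * ln (T%:R : R) + ln (delta I)^-1 <= 4 * Z.
  by move: (ln 2) (ln (T%:R : R)) (ln (delta I)^-1) ln2 lnT_le lnd_le => *; lra.
have rho2 : rho_max I ^+ 2 <= Z ^+ 2 by rewrite lerXn2r ?nnegrE ?rho_max_ge0.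
have m0 : 0 <= (t' - t)%N%:R :> R by [].
have k0 : n * rho_max I ^+ 2 <= Z * Z ^+ 2 by apply: ler_pM; rewrite ?sqr_ge0.
have k00 : 0 <= n * rho_max I ^+ 2 by rewrite mulr_ge0 ?sqr_ge0.
apply: (@le_trans _ _ (2 * (t' - t)%N%:R * (n * rho_max I ^+ 2) * (4 * Z))).
  rewrite -(mulrA (2 * _)); apply: ler_wpM2l => //.
  by apply: mulr_ge0 => //; apply: mulr_ge0.
apply: (@le_trans _ _ (2 * (t' - t)%N%:R * (Z * Z ^+ 2) * (4 * Z))).
  apply: ler_wpM2r; first by rewrite mulr_ge0.
  by apply: ler_wpM2l; rewrite ?mulr_ge0.
have -> : 2 * (t' - t)%N%:R * (Z * Z ^+ 2) * (4 * Z) =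
  8 * Z ^+ 4 * (t' - t)%N%:R by ring.
have -> : (3 * Z ^+ 2) ^+ 2 = 9 * Z ^+ 4 by ring.
by rewrite ler_wpM2r// ler_wpM2r ?exprn_ge0// ler_nat.
Qed.

Lemma mean_arrivals1_le t : (1 <= t <= T)%N -> mean_arrivals I t.-1 t <= Z.
Proof.
move=> tT; apply: le_trans mu_le.
have -> : mean_arrivals I t.-1 t = fine ('E_P[fun w => (arrivals_at t w)%:R])%E.
  rewrite /mean_arrivals; congr (fine ('E_P[_])%E); apply/funext => w.
  by case: t tT => // t _; rewrite /arrivals big_nat1.
apply: (@le_bigmax_seq _ _ _ _ _ _ _
  (fun t => fine ('E_P[fun w => (arrivals_at t w)%:R])%E)) => //.
by rewrite mem_index_iota ltnS.
Qed.

Lemma mean_total_le : mean_total I <= T%:R * Z.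
Proof.
rewrite /mean_total mean_arrivalsE//.
apply: (@le_trans _ _ (\sum_(1 <= s < T.+1) Z)).
  apply: ler_sum_nat => s /andP[s1 sT].
  have := @mean_arrivals1_le s; rewrite s1 -ltnS sT => /(_ isT).
  by rewrite mean_arrivalsE// prednK// big_nat1.
by rewrite sumr_const_nat subSS subn0 -[leLHS]mulr_natl.
Qed.

Let sqrtT1 : 1 <= Num.sqrt (T%:R : R).
Proof. by rewrite -[leLHS]sqrtr1 ler_sqrt// ler1n. Qed.

Let sqrtT_sqr : Num.sqrt (T%:R : R) ^+ 2 = T%:R.
Proof. by rewrite sqr_sqrtr. Qed.

Lemma upN_total_le : upN I 0 T <= 4 * Z ^+ 2 * T%:R.
Proof.
have h1 := mean_total_le; have := confN_le 0 T; rewrite subn0 => h2.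
rewrite /upN -/(mean_total I); apply: le_trans (lerD h1 h2) _.
move: (Num.sqrt _) sqrtT1 sqrtT_sqr => s s1 <-.
have a : s <= s ^+ 2 by rewrite expr2 ler_peMl// (le_trans _ s1).
have b : Z <= Z ^+ 2 by rewrite expr2 ler_peMl.
have s20 : 0 <= s ^+ 2 by rewrite sqr_ge0.
have z20 : 0 <= 3 * Z ^+ 2 by rewrite mulr_ge0 ?sqr_ge0.
have := ler_wpM2l z20 a; have := ler_wpM2l s20 b => *; lra.
Qed.

Lemma upN_gt0 : 0 < upN I 0 T.
Proof. by rewrite ltr_wpDr ?sqrtr_ge0. Qed.

Lemma rate_le_beta : B / upN I 0 T <= Z.
Proof.
apply: le_trans beta_le; rewrite /beta_avg ler_wpM2l//.
by rewrite lef_pV2 ?posrE ?upN_gt0// lerDl sqrtr_ge0.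
Qed.

Lemma L_perish_ge0 : 0 <= L_perish I.
Proof.
have u0 := upN_gt0.
rewrite /L_perish subr_ge0 ler_pdivlMr//; have := P_bar1_le hI u0.
by have := P_bar_ge0 hI lnT1 1; rewrite -subr_ge0; lra.
Qed.

Lemma X_ge0 : 0 <= X. Proof. by case: (X_low_attained hI). Qed.

Lemma X_leZ : X <= Z.
Proof.
by apply: le_trans rate_le_beta; rewrite -subr_ge0; exact: L_perish_ge0.
Qed.

Section OnGood.
Variable w : Omega I.
Hypothesis gw : good w.

Lemma arrivals_ge t t' : (t <= t' <= T)%N ->
  (t' - t)%N%:R <= (arrivals t t' w)%:R :> R.
Proof.
move=> tt'; rewrite ler_nat /arrivals.
(* Some type exists, since otherwise the expected number of arrivals would be 0. *)
have [th0] : exists th0 : Theta I, True.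
  case: (pickP (fun _ : Theta I => true)) => [th _|h0]; first by exists th.
  have : mean_total I = 0.
    rewrite /mean_total mean_arrivalsE//; apply: big1 => s _.
    by apply: big_pred0 => th; have := h0 th.
  by move=> h; have := mean_gt0; rewrite h ltxx.
move=> _; apply: (@leq_trans (\sum_(t.+1 <= s < t'.+1) 1)%N).
  by rewrite sum_nat_const_nat subSS muln1.
rewrite big_nat_cond [leqRHS]big_nat_cond; apply: leq_sum => s sT.
case: gw => /(_ s th0) + _ _ => h; rewrite (bigD1 th0)//=.
apply: leq_trans (leq_addr _ _); apply: h.
move: sT tt' => /andP[/andP[ts st'] _] /andP[_ t'T].
by rewrite (leq_ltn_trans (leq0n t) ts) (leq_trans _ t'T).
Qed.

Lemma upN_sub_arrivals t t' : (t <= t' <= T)%N ->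
  0 <= upN I t t' - (arrivals t t' w)%:R <= 6 * Z ^+ 2 * Num.sqrt (t' - t)%N%:R.
Proof.
move=> tt'; have /andP[h1 h2] := lowN_le gw tt'; have h3 := confN_le t t'.
by move: h1 h2; rewrite /lowN /upN => h1 h2; apply/andP; split; lra.
Qed.

(** Rates lie in [[X, X + L]], and [B / N] exceeds [B / upN = X + L_perish] by
    [(B / upN) * (upN - N) / N], of order [1 / sqrt T] because [N >= T]. *)
Lemma Delta_EF_le :
  Delta_EF I w <= Z * (L + 6 * Z ^+ 3 / Num.sqrt T%:R + L_perish I).
Proof.
have u0 := upN_gt0; have Lp0 := L_perish_ge0; have x0 := X_ge0.
have sT0 : 0 < Num.sqrt (T%:R : R) by exact: lt_le_trans sqrtT1.
have bound0 : 0 <= L + 6 * Z ^+ 3 / Num.sqrt T%:R + L_perish I.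
  have z3 : 0 <= 6 * Z ^+ 3 by rewrite mulr_ge0 ?exprn_ge0.
  have z4 : 0 <= 6 * Z ^+ 3 / Num.sqrt T%:R by rewrite divr_ge0// ltW.
  by apply: addr_ge0 => //; apply: addr_ge0 => //; exact: ltW.
have b0 : 0 <= Z * (L + 6 * Z ^+ 3 / Num.sqrt T%:R + L_perish I).
  by rewrite mulr_ge0.
rewrite /Delta_EF big_nat_cond; apply: bigmax_le => // t; rewrite andbT => tT.
apply: bigmax_le => // th _; rewrite normrM.
have -> : `|util I th| = util I th by rewrite ger0_norm// ltW// util_gt0.
apply: ler_pM => //; first by rewrite ltW ?util_gt0.
  by apply: le_trans util_le; exact: le_bigmax.
rewrite X_algE.
have := rate_between x0 (ltW L_gt0) (P_bar_ge0 hI lnT1)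
  (fun t => upN_ge0 I t T) lnT1 gw (P_bar1_le hI u0) tT.
set N := (arrivals_total w)%:R : R.
have /andP[hu1 hu2] := @upN_sub_arrivals 0 T (leqnn T).
have NT : T%:R <= N by have := @arrivals_ge 0 T (leqnn T); rewrite subn0.
have N0 : 0 < N by apply: lt_le_trans NT; rewrite ltr0n.
have e1 : B / N - B / upN I 0 T = (B / upN I 0 T) * ((upN I 0 T - N) / N).
  by field; rewrite !gt_eqF.
have e2 : 0 <= (upN I 0 T - N) / N by rewrite divr_ge0// ltW.
have e3 : (upN I 0 T - N) / N <= 6 * Z ^+ 2 / Num.sqrt T%:R.
  rewrite ler_pdivrMr//; apply: le_trans hu2 _; rewrite subn0.
  rewrite [leRHS]mulrAC -[leRHS]mulrA; apply: ler_wpM2l.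
    by rewrite mulr_ge0 ?sqr_ge0.
  by rewrite ler_pdivlMr// -expr2 sqrtT_sqr.
have e4 : (B / upN I 0 T) * ((upN I 0 T - N) / N) <=
    Z * (6 * Z ^+ 2 / Num.sqrt T%:R).
  by apply: ler_pM => //; [rewrite divr_ge0// ltW|exact: rate_le_beta].
have e5 : 0 <= (B / upN I 0 T) * ((upN I 0 T - N) / N).
  by rewrite mulr_ge0// divr_ge0// ltW.
have -> : 6 * Z ^+ 3 / Num.sqrt T%:R = Z * (6 * Z ^+ 2 / Num.sqrt T%:R) by ring.
move: e1 e4 e5 Lp0 L_gt0; rewrite /L_perish /X_high.
move=> e1 e4 e5 Lp0 L0 /andP[r1 r2].
rewrite ler_norml; apply/andP; split; lra.
Qed.

Lemma Delta_efficiency_le : Delta_efficiency I w <=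
  (4 * Z ^+ 2 + 9 * Z ^+ 6) * L^-1 + 8 * Z ^+ 2 * (T%:R * L_perish I).
Proof.
have u0 := upN_gt0; have Lp0 := L_perish_ge0; have x0 := X_ge0.
rewrite Delta_efficiencyE.
have [t0 t0T h] := sum_to_given_ge x0 (ltW L_gt0) (P_bar_ge0 hI lnT1)
  (fun t => upN_ge0 I t T) lnT1 gw (P_bar1_le hI u0).
apply: le_trans h _.
have iL : 1 <= L^-1 by rewrite -[leLHS]invr1 lef_pV2 ?posrE.
(* One round has at most [Z + 3 Z^2 <= 4 Z^2] arrivals, and [L <= 1 <= L^-1]. *)
have h1 : (arrivals t0.-1 t0 w)%:R * L <= 4 * Z ^+ 2 * L^-1.
  apply: ler_pM => //; [exact: ltW| |exact: le_trans iL].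
  case: t0 t0T => [_|t0 t0T]; first by rewrite arrivals00 mulr_ge0 ?sqr_ge0.
  have tt : (t0 <= t0.+1 <= T)%N by rewrite leqnSn.
  have /andP[_ ] := @upN_sub_arrivals t0 t0.+1 tt.
  have /andP[_] := lowN_le gw (t := t0) (t' := t0.+1) tt.
  have := confN_le t0 t0.+1; have := @mean_arrivals1_le t0.+1 t0T.
  rewrite succnK subSnn sqrtr1 mulr1 /upN => a1 a2 a3 _.
  have b : Z <= Z ^+ 2 by rewrite expr2 ler_peMl.
  lra.
have h2 : X * (upN I t0 T - (arrivals t0 T w)%:R) - (arrivals t0 T w)%:R * L
    <= 9 * Z ^+ 6 * L^-1.
  have tt : (t0 <= T <= T)%N by rewrite t0T leqnn.
  have /andP[a1 a2] := @upN_sub_arrivals t0 T tt.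
  have a3 := @arrivals_ge t0 T tt.
  set s := Num.sqrt _ in a2.
  have sE : (T - t0)%N%:R = s ^+ 2 :> R by rewrite sqr_sqrtr.
  have a4 : X * (upN I t0 T - (arrivals t0 T w)%:R) <= Z * (6 * Z ^+ 2 * s).
    by apply: ler_pM => //; exact: X_leZ.
  have a5 : s ^+ 2 * L <= (arrivals t0 T w)%:R * L.
    by rewrite -sE ler_wpM2r// ltW.
  (* AM-GM: [6 Z^3 s <= s^2 L + 9 Z^6 / L] *)
  have a6 : 0 <= (3 * Z ^+ 3 - s * L) ^+ 2 / L.
    by rewrite divr_ge0 ?sqr_ge0// ltW.
  have e : (3 * Z ^+ 3 - s * L) ^+ 2 / L =
      9 * Z ^+ 6 * L^-1 - Z * (6 * Z ^+ 2 * s) + s ^+ 2 * L.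
    by field; rewrite gt_eqF.
  move: a6; rewrite e => a6; lra.
(* This difference equals [upN * L_perish]; it occurs twice, hence the constant 8. *)
have h3 : B - X * upN I 0 T <= 4 * Z ^+ 2 * (T%:R * L_perish I).
  have -> : B - X * upN I 0 T = upN I 0 T * L_perish I.
    by rewrite /L_perish; field; rewrite gt_eqF.
  by rewrite mulrA ler_wpM2r// upN_total_le.
lra.
Qed.

End OnGood.
End Bounds.

(** * From explicit bounds to hidden polynomial factors *)

Section Assembly.
Variables (R : realType) (J : Type) (I : J -> instance R).

Lemma for_large_horizonI (Q1 Q2 : J -> Prop) :
  for_large_horizon I Q1 -> for_large_horizon I Q2 ->
  for_large_horizon I (fun j => Q1 j /\ Q2 j).
Proof.
move=> [T1 h1] [T2 h2]; exists (maxn T1 T2) => j; rewrite geq_max => /andP[? ?].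
by split; [exact: h1|exact: h2].
Qed.

Lemma for_large_horizon_mono (Q1 Q2 : J -> Prop) :
  (forall j, Q1 j -> Q2 j) -> for_large_horizon I Q1 -> for_large_horizon I Q2.
Proof. by move=> Q12 [T0 h]; exists T0 => j /h /Q12. Qed.

Lemma large_ln_horizon :
  for_large_horizon I (fun j => 1 <= ln ((horizon (I j))%:R : R)).
Proof.
exists (Num.truncn (expR 1 : R)).+1 => j Tj.
have e0 : expR 1 <= (horizon (I j))%:R :> R.
  apply: le_trans (ltW (truncnS_gt _)) _; by rewrite ler_nat.
rewrite -[leLHS]expRK ler_ln// posrE ?expR_gt0//.
exact: lt_le_trans (expR_gt0 _) e0.
Qed.

(* One plus every parameter but the variances; it is at least 1 and dominates
   these parameters, so that its powers absorb all hidden factors. *)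
Definition scale_poly : mpoly 9 R :=
  1 + mpolyX R (mnm1 (@Ordinal 9 0 isT)) + mpolyX R (mnm1 (@Ordinal 9 1 isT))
    + mpolyX R (mnm1 (@Ordinal 9 2 isT)) + mpolyX R (mnm1 (@Ordinal 9 3 isT))
    + mpolyX R (mnm1 (@Ordinal 9 6 isT)) + mpolyX R (mnm1 (@Ordinal 9 7 isT))
    + mpolyX R (mnm1 (@Ordinal 9 8 isT)).

Definition scale (j : J) : R :=
  1 + beta_avg (I j) + #|Theta (I j)|%:R + util_max (I j) + mu_max (I j)
    + rho_max (I j) + ln (horizon (I j))%:R + ln (delta (I j))^-1.

Lemma hidden_scale j : hidden I scale_poly j = scale j.
Proof.
by rewrite /hidden /scale_poly !mevalD !mevalXU meval1 /params !(tnth_nth 0).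
Qed.

Lemma scale_bounds j : standing (I j) -> 0 <= mean_total (I j) ->
  1 <= ln ((horizon (I j))%:R : R) ->
  [/\ 1 <= scale j, beta_avg (I j) <= scale j, #|Theta (I j)|%:R <= scale j &
      util_max (I j) <= scale j] /\
  [/\ mu_max (I j) <= scale j, rho_max (I j) <= scale j,
      ln ((horizon (I j))%:R : R) <= scale j & ln (delta (I j))^-1 <= scale j].
Proof.
move=> hI m0 lnT; rewrite /scale.
have b0 : 0 <= beta_avg (I j) by rewrite /beta_avg divr_ge0.
have n0 : 0 <= #|Theta (I j)|%:R :> R by [].
have u0 : 0 <= util_max (I j) by exact: bigmax_ge_id.
have mu0 : 0 <= mu_max (I j) by exact: bigmax_ge_id.
have r0 : 0 <= rho_max (I j) by exact: bigmax_ge_id.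
have d0 : 0 <= ln (delta (I j))^-1.
  have /andP[d0 d1] := delta_range hI.
  by apply: ln_ge0; rewrite -[leLHS]invr1 lef_pV2 ?posrE// ltW.
move: (beta_avg _) (#|_|%:R) (util_max _) (mu_max _) (rho_max _) (ln _) (ln _)
  b0 n0 u0 mu0 r0 lnT d0.
by move=> *; do !split; lra.
Qed.

Hypothesis hI : forall j, standing (I j).
Hypothesis hN :
  same_order I (fun j => mean_total (I j)) (fun j => (horizon (I j))%:R).
Hypothesis hLo : vanishing I (fun j => envy (I j)).
Hypothesis hL : lesssim I
  (fun j => 1 / Num.sqrt (horizon (I j))%:R) (fun j => envy (I j)).
Hypothesis hperish : lesssim I (fun j => L_perish (I j))
  (fun j => 1 / Num.sqrt (horizon (I j))%:R).

(** The two rate hypotheses turn [1 / sqrt T] into [p1 * L] and [L_perish] into [p2 * p1 * L], so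
    all of the envy is a polynomial times [L]. Both efficiency terms are kept apart, for either
    regime to merge them. *)
Lemma good_bounds : exists p q r : mpoly 9 R, for_large_horizon I (fun j =>
  [/\ 1 <= ln ((horizon (I j))%:R : R),
      0 <= hidden I p j, 0 <= hidden I q j, 0 <= hidden I r j &
   forall w, good (I := I j) w ->
     Delta_EF (I j) w <= hidden I p j * envy (I j) /\
     Delta_efficiency (I j) w <= hidden I q j * (envy (I j))^-1
       + hidden I r j * ((horizon (I j))%:R * L_perish (I j))]).
Proof.
have [c [C [c0 hc]]] := hN.
have [p1 h1] := hL; have [p2 h2] := hperish.
pose z := scale_poly.
exists (z * (1 + 6%:R * z ^+ 3 * p1 + p2 * p1)),
  (4%:R * z ^+ 2 + 9%:R * z ^+ 6), (8%:R * z ^+ 2).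
have hL1 := hLo ltr01.
apply: for_large_horizon_mono (for_large_horizonI large_ln_horizon
  (for_large_horizonI hc (for_large_horizonI h1 (for_large_horizonI h2 hL1)))).
move=> j [lnT [/andP[cT _] [[p10 h1j] [[p20 h2j] L1]]]].
have T0 : 0 < (horizon (I j))%:R :> R by rewrite ltr0n; exact: horizon_gt0 lnT.
have s0 : 0 < 1 / Num.sqrt (horizon (I j))%:R :> R.
  by rewrite divr_gt0 ?sqrtr_gt0.
have m0 : 0 < mean_total (I j) by apply: lt_le_trans cT; rewrite mulr_gt0.
(* Positivity comes from the lower bound on [envy]: the left side [1 / sqrt T] is positive and the
   hidden factor nonnegative. *)
have L0 : 0 < envy (I j).
  rewrite ltNge; apply/negP => L0.
  have : hidden I p1 j * envy (I j) <= 0 by rewrite mulr_ge0_le0.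
  by move/(le_trans h1j); rewrite leNgt s0.
have Le1 : envy (I j) <= 1 by move: L1; rewrite gtr0_norm// => /ltW.
have [[z1 hb hn hu] [hm hr ht hd]] := scale_bounds (hI j) (ltW m0) lnT.
have z0 : 0 <= scale j by apply: le_trans z1.
have hE1 : hidden I (z * (1 + 6%:R * z ^+ 3 * p1 + p2 * p1)) j =
   scale j * (1 + 6 * scale j ^+ 3 * hidden I p1 j
     + hidden I p2 j * hidden I p1 j).
  rewrite -hidden_scale /hidden.
  by rewrite !(mevalD, mevalM, rmorphXn, meval1, rmorph_nat).
have hE2 : hidden I (4%:R * z ^+ 2 + 9%:R * z ^+ 6) j =
    4 * scale j ^+ 2 + 9 * scale j ^+ 6.
  rewrite -hidden_scale /hidden.
  by rewrite !(mevalD, mevalM, rmorphXn, meval1, rmorph_nat).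
have hE3 : hidden I (8%:R * z ^+ 2) j = 8 * scale j ^+ 2.
  rewrite -hidden_scale /hidden.
  by rewrite !(mevalD, mevalM, rmorphXn, meval1, rmorph_nat).
rewrite hE1 hE2 hE3.
have a1 : 0 <= 6 * scale j ^+ 3 by rewrite mulr_ge0 ?exprn_ge0.
split => //.
- by rewrite mulr_ge0// !addr_ge0 ?mulr_ge0.
- by rewrite addr_ge0 ?mulr_ge0 ?exprn_ge0.
- by rewrite mulr_ge0 ?exprn_ge0.
move=> w gw; split.
  apply: le_trans (Delta_EF_le (hI j) lnT m0 L0 z1 hb hn hu hr ht hd gw) _.
  rewrite -[leRHS]mulrA; apply: ler_wpM2l => //.
  have -> : (1 + 6 * scale j ^+ 3 * hidden I p1 j
      + hidden I p2 j * hidden I p1 j) * envy (I j) =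
    envy (I j) + 6 * scale j ^+ 3 * (hidden I p1 j * envy (I j))
      + hidden I p2 j * (hidden I p1 j * envy (I j)) by ring.
  apply: lerD; first rewrite lerD2l.
    by apply: ler_wpM2l => //; rewrite -[leLHS]mul1r.
  by apply: le_trans h2j _; apply: ler_wpM2l.
exact: Delta_efficiency_le.
Qed.

(** The target event contains the good event and is measurable because both metrics depend on the
    primitive variables only. *)
Lemma whp_of_good (p q : mpoly 9 R) (g : J -> R) :
  for_large_horizon I (fun j => [/\ 1 <= ln ((horizon (I j))%:R : R),
    0 <= hidden I p j, 0 <= hidden I q j &
    forall w, good (I := I j) w ->
      Delta_EF (I j) w <= hidden I p j * envy (I j) /\
      Delta_efficiency (I j) w <= hidden I q j * g j]) ->
  whp_lesssim2 (fun j => Delta_EF (I j)) (fun j => envy (I j))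
    (fun j => Delta_efficiency (I j)) g.
Proof.
move=> H; exists p, q; apply: for_large_horizon_mono H => j [lnT p0 q0 H].
split => //; apply: le_trans (probability_good (hI j) lnT) _.
apply: le_measure; rewrite ?inE.
- exact: measurable_good.
- apply: (measurable_determined (X := @primitives R (I j))) => w w' same /=.
  by rewrite (Delta_EF_ext same) (Delta_efficiency_ext same).
- by move=> w /H.
Qed.

End Assembly.

Theorem corollary3 (R : realType) (J : Type) (I : J -> instance R)
    (hI : forall j, standing (I j))
    (hN : same_order I (fun j => mean_total (I j)) (fun j => (horizon (I j))%:R))
    (hbeta : same_order I (fun j => beta_avg (I j)) (fun=> 1))
    (hLo : vanishing I (fun j => envy (I j)))
    (hL : lesssim I (fun j => 1 / Num.sqrt (horizon (I j))%:R)
                    (fun j => envy (I j)))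
    (hperish : lesssim I (fun j => L_perish (I j))
                         (fun j => 1 / Num.sqrt (horizon (I j))%:R)) :
  (lesssim I (fun j => (horizon (I j))%:R * L_perish (I j))
             (fun j => (envy (I j))^-1) ->
   whp_lesssim2 (fun j => Delta_EF (I j)) (fun j => envy (I j))
                (fun j => Delta_efficiency (I j)) (fun j => (envy (I j))^-1))
  /\
  (lesssim I (fun j => (envy (I j))^-1)
             (fun j => (horizon (I j))%:R * L_perish (I j)) ->
   whp_lesssim2 (fun j => Delta_EF (I j)) (fun j => envy (I j))
                (fun j => Delta_efficiency (I j))
                (fun j => (horizon (I j))%:R * L_perish (I j))).
Proof.
have [p [q [r H]]] := good_bounds hI hN hLo hL hperish.
split=> -[s hs].
  (* Here [s] bounds the perishing term by [L^-1]; in the other regime it bounds the [L^-1] term by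
     the perishing one, giving [q * s + r]. *)
  apply: (@whp_of_good _ _ _ hI p (q + r * s)).
  apply: for_large_horizon_mono (for_large_horizonI H hs).
  move=> j [[lnT p0 q0 r0 Hj] [s0 hsj]].
  have E : hidden I (q + r * s) j = hidden I q j + hidden I r j * hidden I s j.
    by rewrite /hidden mevalD mevalM.
  rewrite E; split => //; first by rewrite addr_ge0 ?mulr_ge0.
  move=> w /Hj[h1 h2]; split => //; apply: le_trans h2 _.
  by rewrite mulrDl lerD2l -mulrA ler_wpM2l.
apply: (@whp_of_good _ _ _ hI p (q * s + r)).
apply: for_large_horizon_mono (for_large_horizonI H hs).
move=> j [[lnT p0 q0 r0 Hj] [s0 hsj]].
have E : hidden I (q * s + r) j = hidden I q j * hidden I s j + hidden I r j.
  by rewrite /hidden mevalD mevalM.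
rewrite E; split => //; first by rewrite addr_ge0 ?mulr_ge0.
move=> w /Hj[h1 h2]; split => //; apply: le_trans h2 _.
by rewrite mulrDl lerD2r -mulrA ler_wpM2l.
Qed.
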